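(* Let $K$ be a field of characteristic $0$, let $d\geq 2$, let $F_d=F_d(\mathfrak M)$ be the free metabelian associative algebra with free generators $x_1,\ldots,x_d$, and let $\delta$ be a Weitzenböck derivation of $F_d$. Let $\delta$ act on the polynomial algebra $K[U_d,V_d]$, $U_d=\{u_1,\ldots,u_d\}$, $V_d=\{v_1,\ldots,v_d\}$, as the derivation acting on $u_1,\ldots,u_d$ and on $v_1,\ldots,v_d$ in the same way as on $x_1,\ldots,x_d$. Then the vector space $(F_d')^{\delta}=\{f\in F_d'\mid \delta(f)=0\}$ of the constants of $\delta$ in the commutator ideal $F_d'$ of $F_d$ is a finitely generated $K[U_d,V_d]^{\delta}$-module.
   Context: All associative algebras are unitary over $K$. Let $A_d=K\langle x_1,\ldots,x_d\rangle$ be the free unitary associative algebra and $A_d'$ its commutator ideal (the two-sided ideal generated by all $[f,g]=fg-gf$, $f,g\in A_d$). The free metabelian associative algebra is $F_d=A_d/(A_d')^2$; it is the relatively free algebra of the variety $\mathfrak M$ defined by the identity $[x_1,x_2][x_3,x_4]=0$. $F_d'$ denotes its commutator ideal (the two-sided ideal generated by all commutators). A Weitzenböck derivation $\delta$ of $F_d$ is a $K$-linear derivation that maps the vector space $KX_d$ with basis $X_d=\{x_1,\ldots,x_d\}$ to itself and acts on it as a nonzero nilpotent linear operator. If $\delta(x_j)=\sum_{i=1}^d\alpha_{ij}x_i$ with $\alpha_{ij}\in K$, then $\delta$ also denotes the derivation of the commutative polynomial algebra $K[U_d,V_d]=K[u_1,\ldots,u_d,v_1,\ldots,v_d]$ determined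 by $\delta(u_j)=\sum_{i=1}^d\alpha_{ij}u_i$ and $\delta(v_j)=\sum_{i=1}^d\alpha_{ij}v_i$. $K[U_d,V_d]^{\delta}$ is the kernel of $\delta$ in $K[U_d,V_d]$. The commutator ideal $F_d'$ is a $K[U_d,V_d]$-module via $fu_i=x_if$ and $fv_i=[f,x_i]=fx_i-x_if$ for $f\in F_d'$, $i=1,\ldots,d$ (these operators commute because of the metabelian identity). With this action $(F_d')^{\delta}$ is a $K[U_d,V_d]^{\delta}$-module. *)

(* Defs.v *)
From HB Require Import structures.
From mathcomp Require Import all_boot all_order all_algebra.
From mathcomp Require Import boolp.
From mathcomp Require Import ssrcomplements monalg mpoly.

Set Implicit Arguments.
Unset Strict Implicit.
Unset Printing Implicit Defensive.

Import GRing.Theory.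
Local Open Scope ring_scope.
Local Open Scope quotient_scope.

Section Ideals.
Variable R : pzRingType.
Implicit Types (S I J : R -> Prop).

Inductive ideal_gen S : R -> Prop :=
| ideal_gen_sub f of S f : ideal_gen S f
| ideal_gen0 : ideal_gen S 0
| ideal_genD f g of ideal_gen S f & ideal_gen S g : ideal_gen S (f + g)
| ideal_genMl h f of ideal_gen S f : ideal_gen S (h * f)
| ideal_genMr h f of ideal_gen S f : ideal_gen S (f * h).

Definition commutator_ideal : R -> Prop :=
  ideal_gen (fun h => exists f g, h = f * g - g * f).

Definition ideal_mul I J : R -> Prop :=
  ideal_gen (fun h => exists f g, [/\ I f, J g & h = f * g]).

Lemma ideal_genN S f : ideal_gen S f -> ideal_gen S (- f).
Proof. by rewrite -mulN1r; apply: ideal_genMl. Qed.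

End Ideals.

Lemma ideal_gen_ker (R S : pzRingType) (phi : {rmorphism R -> S})
    (G : R -> Prop) f :
  (forall g, G g -> phi g = 0) -> ideal_gen G f -> phi f = 0.
Proof.
move=> G0; elim=> [g /G0//||g h _ e1 _ e2|g h _ e|g h _ e].
- exact: rmorph0.
- by rewrite rmorphD e1 e2 addr0.
- by rewrite rmorphM e mulr0.
- by rewrite rmorphM e mul0r.
Qed.

Lemma commutator_ideal_ker (R : pzRingType) (S : comPzRingType)
  (phi : {rmorphism R -> S}) f : commutator_ideal f -> phi f = 0.
Proof.
apply: ideal_gen_ker => _ [g [h ->]].
by rewrite rmorphB !rmorphM mulrC subrr.
Qed.

Lemma commutator_ideal_im (R S : pzRingType) (phi : {rmorphism R -> S}) f :
  (forall g, exists h, phi h = g) ->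
  commutator_ideal f -> exists2 h, commutator_ideal h & f = phi h.
Proof.
move=> surj.
elim=> {f} [_ [g [h ->]]||_ _ _ [f ? ->] _ [g ? ->]|h _ _ [f ? ->]|h _ _ [f ? ->]].
- have [[g' <-] [h' <-]] := (surj g, surj h); rewrite -!rmorphM -rmorphB.
  by exists (g' * h' - h' * g') => //; apply: ideal_gen_sub; exists g', h'.
- by exists 0; [exact: ideal_gen0 | rewrite rmorph0].
- by exists (f + g); [exact: ideal_genD | rewrite rmorphD].
- have [h' <-] := surj h.
  by exists (h' * f); [exact: ideal_genMl | rewrite rmorphM].
- have [h' <-] := surj h.
  by exists (f * h'); [exact: ideal_genMr | rewrite rmorphM].
Qed.

Section FreeMetabelian.
Variables (K : fieldType) (d : nat).

Definition free_alg : Type := {malg K[{fmonom 'I_d}]}.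
HB.instance Definition _ := GRing.Lalgebra.on free_alg.

Fact free_alg_scaleAr (a : K) (f g : free_alg) : a *: (f * g) = f * (a *: g).
Proof.
have aC (h : free_alg) : (malgC a : free_alg) * h = h * malgC a.
  rewrite !malgM_def fgmulgU fgmulUg; apply: eq_bigr => m _.
  by rewrite mulrC mul1m mulm1.
by rewrite -!mul_malgC !mulrA aC.
Qed.
HB.instance Definition _ := GRing.Lalgebra_isAlgebra.Build K free_alg
  free_alg_scaleAr.

Definition metab_ideal : {pred free_alg} :=
  fun f => `[< ideal_mul (@commutator_ideal free_alg)
                         (@commutator_ideal free_alg) f >].

Lemma metab_idealP f :
  reflect (ideal_mul (@commutator_ideal free_alg)
                     (@commutator_ideal free_alg) f) (f \in metab_ideal).
Proof. exact: asboolP. Qed.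

Fact metab_ideal_zmod_closed : zmod_closed metab_ideal.
Proof.
split=> [|f g]; first by apply/metab_idealP; exact: ideal_gen0.
move=> /metab_idealP fI /metab_idealP gI; apply/metab_idealP.
by apply: ideal_genD => //; apply: ideal_genN.
Qed.
HB.instance Definition _ := GRing.isZmodClosed.Build free_alg metab_ideal
  metab_ideal_zmod_closed.

Lemma metab_idealMl h f : f \in metab_ideal -> h * f \in metab_ideal.
Proof. by move=> /metab_idealP fI; apply/metab_idealP; apply: ideal_genMl. Qed.

Lemma metab_idealMr h f : f \in metab_ideal -> f * h \in metab_ideal.
Proof. by move=> /metab_idealP fI; apply/metab_idealP; apply: ideal_genMr. Qed.

Lemma metab_ideal1 : 1 \notin metab_ideal.
Proof.
pose phi : {rmorphism free_alg -> K} := @monalg.mcoeff _ K mone.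
apply/negP => /metab_idealP /(@ideal_gen_ker _ _ phi) phi1.
suff /eqP : phi 1 = 0 by rewrite rmorph1 oner_eq0.
apply: phi1 => _ [f [g [fI _ ->]]].
by rewrite rmorphM (commutator_ideal_ker phi fI) mul0r.
Qed.

(* A_d / (A_d')^2 *)
Definition metab := {ideal_quot metab_ideal}.

HB.instance Definition _ := Choice.on metab.
HB.instance Definition _ := GRing.Zmodule.on metab.

Definition metab_proj (f : free_alg) : metab := \pi_{ideal_quot metab_ideal} f.

Lemma metab_projP f g : (metab_proj f == metab_proj g) = (f - g \in metab_ideal).
Proof. by rewrite /metab_proj Quotient.idealrBE. Qed.

Let projK (f : metab) : metab_proj (repr f) = f.
Proof. by rewrite /metab_proj reprK. Qed.

Fact metab_proj_zmod_morphism : zmod_morphism metab_proj.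
Proof. by move=> f g; rewrite /metab_proj !piE. Qed.
HB.instance Definition _ := GRing.isZmodMorphism.Build free_alg metab metab_proj
  metab_proj_zmod_morphism.

Definition metab_mul : metab -> metab -> metab :=
  lift_op2 {ideal_quot metab_ideal} *%R.
Definition metab_scale (a : K) : metab -> metab :=
  lift_op1 {ideal_quot metab_ideal} ( *:%R a).

Let repr_equiv f : repr (metab_proj f) - f \in metab_ideal.
Proof. by rewrite -metab_projP projK. Qed.

Let projM f g : metab_proj (f * g) = metab_mul (metab_proj f) (metab_proj g).
Proof.
unlock metab_mul; apply/eqP; rewrite eq_sym metab_projP.
set f' := repr _; set g' := repr _.
have -> : f' * g' - f * g = (f' - f) * g' + f * (g' - g).
  by rewrite mulrBl mulrBr addrA subrK.
apply: rpredD; first exact/metab_idealMr/repr_equiv.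
exact/metab_idealMl/repr_equiv.
Qed.

Let projZ a f : metab_proj (a *: f) = metab_scale a (metab_proj f).
Proof.
unlock metab_scale; apply/eqP; rewrite eq_sym metab_projP.
rewrite -scalerBr -[_ - _]mul1r scalerAl.
exact/metab_idealMl/repr_equiv.
Qed.

Fact metab_mulA : associative metab_mul.
Proof.
by move=> f g h; rewrite -[f]projK -[g]projK -[h]projK -!projM mulrA.
Qed.
Fact metab_mul1l : left_id (metab_proj 1) metab_mul.
Proof. by move=> f; rewrite -[f]projK -!projM mul1r. Qed.
Fact metab_mul1r : right_id (metab_proj 1) metab_mul.
Proof. by move=> f; rewrite -[f]projK -!projM mulr1. Qed.
Fact metab_mulDl : left_distributive metab_mul +%R.
Proof.
move=> f g h; rewrite -[f]projK -[g]projK -[h]projK.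
by rewrite -raddfD -!projM mulrDl raddfD.
Qed.
Fact metab_mulDr : right_distributive metab_mul +%R.
Proof.
move=> f g h; rewrite -[f]projK -[g]projK -[h]projK.
by rewrite -raddfD -!projM mulrDr raddfD.
Qed.
Fact metab_one_neq0 : metab_proj 1 != 0.
Proof.
by rewrite -(raddf0 metab_proj) metab_projP subr0 metab_ideal1.
Qed.
HB.instance Definition _ := GRing.Zmodule_isNzRing.Build metab
  metab_mulA metab_mul1l metab_mul1r metab_mulDl metab_mulDr metab_one_neq0.

Fact metab_scaleA a b f : metab_scale a (metab_scale b f) = metab_scale (a * b) f.
Proof. by rewrite -[f]projK -!projZ scalerA. Qed.
Fact metab_scale1 : left_id 1 metab_scale.
Proof. by move=> f; rewrite -[f]projK -!projZ scale1r. Qed.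
Fact metab_scaleDr : right_distributive metab_scale +%R.
Proof.
move=> a f g; rewrite -[f]projK -[g]projK -raddfD -!projZ.
by rewrite scalerDr raddfD.
Qed.
Fact metab_scaleDl f : {morph metab_scale^~ f : a b / a + b}.
Proof. by move=> a b; rewrite -[f]projK -!projZ scalerDl raddfD. Qed.
HB.instance Definition _ := GRing.Zmodule_isLmodule.Build K metab
  metab_scaleA metab_scale1 metab_scaleDr metab_scaleDl.

Lemma metab_projM f g : metab_proj (f * g) = metab_proj f * metab_proj g.
Proof. exact: projM. Qed.
Lemma metab_projZ a f : metab_proj (a *: f) = a *: metab_proj f.
Proof. exact: projZ. Qed.

Fact metab_scaleAl a (f g : metab) : a *: (f * g) = (a *: f) * g.
Proof.
rewrite -[f]projK -[g]projK -(metab_projM (repr f)) -(metab_projZ a (repr f)).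
by rewrite -(metab_projM (a *: repr f)) -(metab_projZ a (_ * _)) scalerAl.
Qed.
HB.instance Definition _ := GRing.Lmodule_isLalgebra.Build K metab metab_scaleAl.

Fact metab_scaleAr a (f g : metab) : a *: (f * g) = f * (a *: g).
Proof.
rewrite -[f]projK -[g]projK -(metab_projM (repr f)) -(metab_projZ a (repr g)).
by rewrite -(metab_projM _ (a *: repr g)) -(metab_projZ a (_ * _)) scalerAr.
Qed.
HB.instance Definition _ := GRing.Lalgebra_isAlgebra.Build K metab metab_scaleAr.

Fact metab_proj_monoid_morphism : monoid_morphism metab_proj.
Proof. by split=> // f g; rewrite metab_projM. Qed.
HB.instance Definition _ := GRing.isMonoidMorphism.Build free_alg metab metab_proj
  metab_proj_monoid_morphism.

Lemma metab_commutator_idealM (f g : metab) :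
  commutator_ideal f -> commutator_ideal g -> f * g = 0.
Proof.
have surj h : exists h', metab_proj h' = h by exists (repr h).
move=> /(commutator_ideal_im surj)[f' f'I ->].
move=> /(commutator_ideal_im surj)[g' g'I ->].
apply/eqP; rewrite -metab_projM -(raddf0 metab_proj) metab_projP subr0.
by apply/metab_idealP/ideal_gen_sub; exists f', g'.
Qed.

Definition xvar (i : 'I_d) : metab := metab_proj << fmu i >>.

End FreeMetabelian.

Section Derivations.
Variables (K : fieldType) (A : algType K).

Definition derivation (D : A -> A) : Prop :=
  linear D /\ (forall f g, D (f * g) = D f * g + f * D g).

Definition constants (D : A -> A) : A -> Prop := fun f => D f = 0.

End Derivations.

Section Weitzenboeck.
Variables (K : fieldType) (d : nat).
Implicit Types (f : metab K d) (delta : metab K d -> metab K d).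

Definition span_xvar f : Prop :=
  exists a : 'I_d -> K, f = \sum_(i < d) a i *: xvar K i.

Definition weitzenboeck delta : Prop :=
  [/\ derivation delta,
      forall f, span_xvar f -> span_xvar (delta f),
      exists2 f, span_xvar f & delta f != 0 &
      exists n, forall f, span_xvar f -> iter n delta f = 0].

End Weitzenboeck.

Section PolyVars.
Variables (K : fieldType) (d : nat).

(* [mpoly n K] is spelled out because monalg's notation shadows {mpoly K[n]}. *)
Definition uvar (i : 'I_d) : mpoly (d + d) K := 'X_(lshift d i).
Definition vvar (i : 'I_d) : mpoly (d + d) K := 'X_(rshift d i).

End PolyVars.

Section Action.
Variables (K : fieldType) (d : nat) (A : algType K) (x : 'I_d -> A).
Notation P := (mpoly (d + d) K).
Notation I := (@commutator_ideal A).
Implicit Types (f g : A) (p q : P) (m : 'X_{1..d + d}) (k : 'I_(d + d)).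

Definition act_var k f : A :=
  match split k with
  | inl i => x i * f
  | inr i => f * x i - x i * f
  end.

Definition act_monom m f : A :=
  foldr (fun k g => iter (m k) (act_var k) g) f (enum 'I_(d + d)).

(* [act p f] is the element written f p in right-module notation. The
   operators [act_var k] commute with each other on the commutator ideal of a
   metabelian algebra only, so this is a module structure there and not on the
   whole algebra. *)
Definition act p f : A := \sum_(m <- msupp p) p@_m *: act_monom m f.

Definition finitely_generated (S : P -> Prop) (M : A -> Prop) : Prop :=
  exists n (g : 'I_n -> A),
    (forall i, M (g i)) /\
    forall f, M f -> exists p : 'I_n -> P,
      (forall i, S (p i)) /\ f = \sum_(i < n) act (p i) (g i).

Lemma act_var_is_linear k : linear (act_var k).
Proof.
move=> a f g; rewrite /act_var; case: (split k) => i.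
  by rewrite mulrDr scalerAr.
rewrite mulrDl mulrDr -scalerAl -scalerAr scalerBr.
by rewrite opprD addrACA.
Qed.

Lemma iter_act_var_is_linear n k : linear (iter n (act_var k)).
Proof.
elim: n => [//|n IH] a f g.
by rewrite !iterS IH act_var_is_linear.
Qed.

Lemma act_monom_is_linear m : linear (act_monom m).
Proof.
move=> a f g; rewrite /act_monom; elim: (enum _) => //= k s ->.
exact: iter_act_var_is_linear.
Qed.

Lemma act_linearr p : linear (act p).
Proof.
move=> a f g; rewrite /act scaler_sumr -big_split; apply: eq_bigr => m _ /=.
by rewrite act_monom_is_linear scalerDr !scalerA mulrC.
Qed.

Lemma actEw n p f : (msize p <= n)%N ->
  act p f = \sum_(m : bmultinom (d + d) n) p@_m *: act_monom m f.
Proof.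
move=> le_pn; pose J : subFinType _ := bmultinom (d + d) n.
rewrite /act (big_mksub J) ?msupp_uniq //=; first last.
  by move=> m /msize_mdeg_lt /leq_trans; apply.
by rewrite big_rmcond //= => m /memN_msupp_eq0 ->; rewrite scale0r.
Qed.

Lemma act_linearl f : linear (act^~ f).
Proof.
move=> a p q; pose n := maxn (msize (a *: p + q)) (maxn (msize p) (msize q)).
rewrite !(@actEw n) ?leq_max ?leqnn ?orbT //.
rewrite scaler_sumr -big_split; apply: eq_bigr => m _ /=.
by rewrite mcoeffD mcoeffZ scalerDl scalerA.
Qed.

Lemma act0l f : act 0 f = 0. Proof. by rewrite /act msupp0 big_nil. Qed.

Lemma actX m f : act 'X_[m] f = act_monom m f.
Proof. by rewrite /act msuppX big_seq1 mcoeffX eqxx scale1r. Qed.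

Lemma act1 f : act 1 f = f.
Proof.
rewrite -mpolyX0 actX /act_monom; elim: (enum _) => //= k s IH.
by rewrite mnm0E.
Qed.

Lemma act_monomU k f : act_monom U_(k)%MM f = act_var k f.
Proof.
rewrite /act_monom.
have U s : uniq s -> foldr (fun j g => iter (U_(k)%MM j) (act_var j) g) f s
    = if k \in s then act_var k f else f.
  elim: s => //= j s IH /andP[js us]; rewrite IH // mnm1E in_cons.
  by have [kj|//] := eqVneq k j; rewrite kj (negPf js).
by rewrite U ?enum_uniq // mem_enum.
Qed.

Lemma act_u i f : act (uvar K i) f = x i * f.
Proof. by rewrite actX act_monomU /act_var (unsplitK (inl i)). Qed.

Lemma act_v i f : act (vvar K i) f = f * x i - x i * f.
Proof. by rewrite actX act_monomU /act_var (unsplitK (inr i)). Qed.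

Lemma act_var_ideal k f : I f -> I (act_var k f).
Proof.
rewrite /act_var; case: (split k) => i fI; first exact: ideal_genMl.
by apply: ideal_genD; [exact: ideal_genMr | apply/ideal_genN/ideal_genMl].
Qed.

Lemma act_monom_ideal m f : I f -> I (act_monom m f).
Proof.
move=> fI; rewrite /act_monom; elim: (enum _) => //= k s IH.
by elim: (m k) => //= n; apply: act_var_ideal.
Qed.

Lemma act_ideal p f : I f -> I (act p f).
Proof.
move=> fI; rewrite /act; elim/big_ind: _ => [|? ?|m _].
- exact: ideal_gen0.
- exact: ideal_genD.
- by rewrite -[act_monom _ _]mul1r scalerAl; apply/ideal_genMl/act_monom_ideal.
Qed.

Hypothesis metabelian : forall f g, I f -> I g -> f * g = 0.

Lemma act_varC k l f : I f -> act_var k (act_var l f) = act_var l (act_var k f).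
Proof.
move=> fI.
have C i j : I (x i * x j - x j * x i).
  by apply: ideal_gen_sub; exists (x i), (x j).
have L i j : x i * x j * f = x j * x i * f.
  by apply/eqP; rewrite -subr_eq0 -mulrBl (metabelian (C i j) fI).
have R i j : f * x i * x j = f * x j * x i.
  by apply/eqP; rewrite -subr_eq0 -!mulrA -mulrBr (metabelian fI (C i j)).
rewrite /act_var; case: (split k) => i; case: (split l) => j.
- by rewrite !mulrA L.
- by rewrite mulrBr !mulrA (L i).
- by rewrite mulrBr !mulrA (L i).
- rewrite !mulrBl !mulrBr !mulrA (R j) (L i) !opprB !addrA.
  rewrite -!addrA; congr (_ + _).
  by rewrite [LHS]addrCA [RHS]addrCA; congr (_ + _); exact: addrC.
Qed.

Lemma act_monomD m1 m2 f : I f ->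
  act_monom (m1 + m2) f = act_monom m1 (act_monom m2 f).
Proof.
have itI n k g : I g -> I (iter n (act_var k) g).
  by move=> gI; elim: n => //= n; apply: act_var_ideal.
have foldI m s g : I g -> I (foldr (fun k => iter (m k) (act_var k)) g s).
  by move=> gI; elim: s => //= k s; apply: itI.
have C1 n k l g : I g ->
    act_var l (iter n (act_var k) g) = iter n (act_var k) (act_var l g).
  by move=> gI; elim: n => //= n <-; rewrite act_varC //; apply: itI.
have C2 n n' k l g : I g -> iter n' (act_var l) (iter n (act_var k) g)
    = iter n (act_var k) (iter n' (act_var l) g).
  by move=> gI; elim: n' => //= n' ->; rewrite C1 //; apply: itI.
have C3 m n k s g : I g ->
    iter n (act_var k) (foldr (fun k => iter (m k) (act_var k)) g s)
    = foldr (fun k => iter (m k) (act_var k)) (iter n (act_var k) g) s.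
  by move=> gI; elim: s => //= l s <-; rewrite C2 //; apply: foldI.
move=> fI; rewrite /act_monom; elim: (enum _) => //= k s ->.
by rewrite mnmDE iterD -C3 //; apply: foldI.
Qed.

Lemma actM p q f : I f -> act (p * q) f = act p (act q f).
Proof.
move=> fI.
have act0r r : act r 0 = 0.
  by have := act_linearr r (-1) 0 0; rewrite scaler0 addr0 scaleN1r addNr.
elim/mpolyind: p => [|c m p _ _ IH]; first by rewrite mul0r !act0l.
rewrite mulrDl -scalerAl !act_linearl IH; congr (c *: _ + _) => {IH p}.
elim/mpolyind: q => [|a n q _ _ IH]; first by rewrite mulr0 !act0l act0r.
rewrite mulrDr -scalerAr !act_linearl act_linearr IH; congr (a *: _ + _).
by rewrite -mpolyXD !actX act_monomD.
Qed.

Section ActDerivation.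
Variables (delta : A -> A) (deltaP : P -> P) (alpha : 'M[K]_d).
Hypotheses (Ddelta : derivation delta) (DdeltaP : derivation deltaP).
Hypothesis delta_x :
  forall j, delta (x j) = \sum_(i < d) alpha i j *: x i.
Hypothesis delta_u :
  forall j, deltaP (uvar K j) = \sum_(i < d) alpha i j *: uvar K i.
Hypothesis delta_v :
  forall j, deltaP (vvar K j) = \sum_(i < d) alpha i j *: vvar K i.

Let deltaD f g : delta (f + g) = delta f + delta g.
Proof. by have := Ddelta.1 1 f g; rewrite !scale1r. Qed.
Let delta0 : delta 0 = 0.
Proof. by apply: (addrI (delta 0)); rewrite -deltaD !addr0. Qed.
Let deltaN f : delta (- f) = - delta f.
Proof. by have := Ddelta.1 (-1) f 0; rewrite !scaleN1r delta0 !addr0. Qed.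

Lemma derivation_ideal f : I f -> I (delta f).
Proof.
elim=> {f} [_ [f [g ->]]||f g _ fI _ gI|h f fI dI|h f fI dI].
- rewrite deltaD deltaN !Ddelta.2.
  have -> : delta f * g + f * delta g - (delta g * f + g * delta f)
      = (delta f * g - g * delta f) + (f * delta g - delta g * f).
    by rewrite opprD -!addrA; congr (_ + _); rewrite addrA addrC.
  by apply: ideal_genD; apply: ideal_gen_sub;
    [exists (delta f), g | exists f, (delta g)].
- by rewrite delta0; apply: ideal_gen0.
- by rewrite deltaD; apply: ideal_genD.
- by rewrite Ddelta.2; apply: ideal_genD; apply: ideal_genMl.
- by rewrite Ddelta.2; apply: ideal_genD; apply: ideal_genMr.
Qed.

Lemma act_suml (T : finType) (c : T -> K) (p : T -> P) f :
  act (\sum_i c i *: p i) f = \sum_i c i *: act (p i) f.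
Proof.
elim: (index_enum T) => [|i s IH]; first by rewrite !big_nil act0l.
by rewrite !big_cons act_linearl IH.
Qed.

Lemma derivation_act p f : I f ->
  delta (act p f) = act (deltaP p) f + act p (delta f).
Proof.
have PD q r : deltaP (q + r) = deltaP q + deltaP r.
  by have := DdeltaP.1 1 q r; rewrite !scale1r.
have P0 : deltaP 0 = 0 by apply: (addrI (deltaP 0)); rewrite -PD !addr0.
have P1 : deltaP 1 = 0.
  have := DdeltaP.2 1 1; rewrite !mulr1 mul1r => /eqP.
  by rewrite eq_sym -subr_eq0 addrK => /eqP.
have aD q r g : act (q + r) g = act q g + act r g.
  by have := act_linearl g 1 q r; rewrite !scale1r.
have aDr q g h : act q (g + h) = act q g + act q h.
  by have := act_linearr q 1 g h; rewrite !scale1r.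
pose C q := forall f, I f ->
  delta (act q f) = act (deltaP q) f + act q (delta f).
have CM q r : C q -> C r -> C (q * r).
  move=> Cq Cr g gI; have dgI := derivation_ideal gI.
  have rI := act_ideal r gI.
  by rewrite actM // Cq // Cr // DdeltaP.2 aD aDr !actM // addrA.
have C1 : C 1 by move=> g gI; rewrite P1 act0l add0r !act1.
have CX k : C 'X_k.
  move=> g gI; case: (split_ordP k) => i ->; rewrite -?/(uvar K i) -?/(vvar K i).
    rewrite act_u Ddelta.2 delta_x delta_u act_suml act_u mulr_suml.
    by congr (_ + _); apply: eq_bigr => j _; rewrite act_u scalerAl.
  rewrite act_v deltaD deltaN !Ddelta.2 delta_x delta_v act_suml act_v.
  have -> : \sum_j alpha j i *: act (vvar K j) g
      = g * (\sum_j alpha j i *: x j) - (\sum_j alpha j i *: x j) * g.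
    rewrite mulr_sumr mulr_suml -sumrB; apply: eq_bigr => j _.
    by rewrite act_v scalerBr scalerAr scalerAl.
  by rewrite opprD -!addrA addrCA; congr (_ + _); exact: addrCA.
move: f; rewrite -/(C p); elim/mpolyind: p => [|c m p _ _ Cp] f fI.
  by rewrite P0 !act0l delta0 addr0.
have CXm : C 'X_[m].
  rewrite mpolyXE_id; apply: (big_ind C C1 CM) => k _.
  elim: (m k) => [|n IH]; first by rewrite expr0.
  by rewrite exprS; exact: CM (CX k) IH.
rewrite act_linearl DdeltaP.1 (act_linearl f) Ddelta.1 (act_linearl (delta f)).
have -> := CXm f fI; have -> := Cp f fI.
by rewrite scalerDr addrACA.
Qed.

(* The constants of the commutator ideal form a module over those of K[U,V]. *)
Lemma constants_act p f : constants deltaP p -> I f -> constants delta f ->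
  I (act p f) /\ constants delta (act p f).
Proof.
move=> p0 fI f0; split; first exact: act_ideal.
have act0r : act p 0 = 0.
  by have := act_linearr p (-1) 0 0; rewrite scaler0 addr0 scaleN1r addNr.
by rewrite /constants derivation_act // p0 f0 act0l act0r addr0.
Qed.

End ActDerivation.

End Action.

(* Main.v *)
From HB Require Import structures.
Require Import Defs.
From mathcomp Require Import all_boot all_order all_algebra.
From mathcomp Require Import boolp ring.
From mathcomp Require monalg.
From mathcomp Require Import mpoly.

Set Implicit Arguments.
Unset Strict Implicit.
Unset Printing Implicit Defensive.

Import Order.TTheory GRing.Theory.
Local Open Scope ring_scope.

(* The Magnus matrices x_i -> [[u_i, y_i], [0, u_i + v_i]] over K[U, V, Y] send f in
   F_d' to a strictly upper triangular matrix with entry L f, where L(f p) = p L f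
   and L [x_i, x_j] = y_i v_j - y_j v_i. The Koszul homotopy for v_1, ..., v_d shows
   that L is injective on F_d'; it intertwines delta with the derivation D of K[U, V,
   Y] acting on U, V and Y as delta acts on X. So it suffices that every set T of
   constants of D contains finitely many elements whose combinations with
   coefficients in ker D cover T: setting Y = 0 in the coefficients then gives
   coefficients in K[U, V]^delta.

   By the Jordan form, D is the raising operator e of an sl_2-triple of linear
   derivations. Adjoining two variables s and tau spanning the natural module
   identifies ker e with the sl_2-invariants. For a set of invariants, Hilbert's
   basis theorem gives t = sum_i a_i g_i with finitely many g_i in the set, and a
   Reynolds operator (the zero weight projection followed by the extremal projector)
   makes the a_i invariant. *)

(** * Dickson's lemma and Hilbert's basis theorem *)

Lemma nat_tail_min (f : nat -> nat) N :
  exists2 n, (N <= n)%N & forall m, (n <= m)%N -> (f n <= f m)%N.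
Proof.
have [k] := ubnP (f N); elim: k N => // k IH N leN.
have [minN|] := pselect (forall m, (N <= m)%N -> (f N <= f m)%N).
  by exists N.
move=> /existsNP[m] /not_implyP[leNm] /negP; rewrite -ltnNge => lt_m.
have [n le_mn minn] := IH m (leq_trans lt_m leN).
by exists n => //; exact: leq_trans le_mn.
Qed.

(** Each index is a point where [f] is minimal on its tail, chosen strictly beyond the previous one,
    so the values never drop. *)
Lemma nondecreasing_subseq (f : nat -> nat) :
  exists2 g : nat -> nat, {homo g : i j / (i < j)%N} &
    forall i j, (i < j)%N -> (f (g i) <= f (g j))%N.
Proof.
have /choice[c cP] : forall N, exists n,
    (N <= n)%N /\ forall m, (n <= m)%N -> (f n <= f m)%N.
  by move=> N; have [n] := nat_tail_min f N; exists n.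
pose g i := iter i (fun n => c n.+1) (c 0).
have gmono : {homo g : i j / (i < j)%N}.
  apply: homo_ltn => [y x z|i]; first exact: ltn_trans.
  exact: (cP _).1.
exists g => // i j ij; have gij := gmono _ _ ij.
by case: i {ij} gij => [|i] gij; apply: (cP _).2; apply: ltnW.
Qed.

Section Hilbert.
Variables (K : fieldType) (n : nat).
Notation P := {mpoly K[n]}.

(** Refining to a subsequence once per coordinate makes all coordinates nondecreasing; its first two
    terms then compare. *)
Lemma dickson (s : nat -> 'X_{1..n}) :
  exists i j, (i < j)%N /\ (s i <= s j)%MM.
Proof.
have sub m : exists2 g : nat -> nat, {homo g : i j / (i < j)%N} &
    forall k : 'I_n, (k < m)%N ->
      forall i j, (i < j)%N -> (s (g i) k <= s (g j) k)%N; last first.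
  have [g gmono gP] := sub n.
  exists (g 0%N), (g 1%N); split; first exact: gmono.
  by apply/mnm_lepP => k; apply: gP.
elim: m => [|m [g gmono gP]]; first by exists id.
have [lt_mn|le_nm] := ltnP m n; last first.
  by exists g => // k _ i j; apply: gP; apply: leq_trans le_nm.
have [h hmono hP] := nondecreasing_subseq (fun i => s (g i) (Ordinal lt_mn)).
exists (g \o h) => [i j /hmono/gmono//|k].
rewrite ltnS leq_eqVlt => /predU1P[km|km] i j ij /=.
  by have -> : k = Ordinal lt_mn; [exact: val_inj | exact: hP].
by apply: gP => //; apply: hmono.
Qed.

Implicit Types (gs : seq P) (p q : P) (T : P -> Prop).

(** Coefficients are indexed by the generators themselves, so [undup] keeps a repeated generator
    from being counted twice. *)
Definition in_ideal gs p := exists c : P -> P, p = \sum_(g <- undup gs) c g * g.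

Lemma in_ideal0 gs : in_ideal gs 0.
Proof. by exists (fun=> 0); rewrite big1 // => g _; rewrite mul0r. Qed.

Lemma in_idealD gs p q : in_ideal gs p -> in_ideal gs q -> in_ideal gs (p + q).
Proof.
move=> [c ->] [c' ->]; exists (fun g => c g + c' g).
by rewrite -big_split; apply: eq_bigr => g _; rewrite /= mulrDl.
Qed.

Lemma in_idealM gs p q : in_ideal gs q -> in_ideal gs (p * q).
Proof.
move=> [c ->]; exists (fun g => p * c g).
by rewrite mulr_sumr; apply: eq_bigr => g _; rewrite mulrA.
Qed.

Lemma in_ideal_gen gs g : g \in gs -> in_ideal gs g.
Proof.
move=> gs_g; exists (fun h => (h == g)%:R).
rewrite (bigD1_seq g) ?mem_undup ?undup_uniq //= eqxx mul1r big1 ?addr0 //.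
by move=> h /negPf->; rewrite mul0r.
Qed.

Lemma in_ideal_sum gs (I : eqType) (r : seq I) (F : I -> P) :
  (forall i, i \in r -> in_ideal gs (F i)) -> in_ideal gs (\sum_(i <- r) F i).
Proof.
move=> FP; rewrite big_seq; elim/big_ind: _ => //; first exact: in_ideal0.
exact: in_idealD.
Qed.

Lemma in_ideal_trans gs gs' p :
  (forall g, g \in gs -> in_ideal gs' g) -> in_ideal gs p -> in_ideal gs' p.
Proof.
move=> sub [c ->]; apply: in_ideal_sum => g; rewrite mem_undup => gs_g.
by apply: in_idealM; apply: sub.
Qed.

(** Division by a Groebner basis: subtracting a multiple of some [g] cancels the leading term, and
    the monomial order is well founded. *)
Lemma in_ideal_mlead (I : P -> Prop) gs p :
  (forall p q, I p -> I q -> I (p - q)) -> (forall p q, I q -> I (p * q)) ->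
  (forall g, g \in gs -> I g /\ g != 0) ->
  (forall p, I p -> p != 0 -> exists2 g, g \in gs & (mlead g <= mlead p)%MM) ->
  I p -> in_ideal gs p.
Proof.
move=> IB IM gsP redP; move: p.
suff leadP m : forall p, p = 0 \/ mlead p = m -> I p -> in_ideal gs p.
  by move=> p; apply: (leadP (mlead p)); right.
elim/(well_founded_ind (@ltom_wf n)): m => m IH p mp Ip.
have [->|p0] := eqVneq p 0; first exact: in_ideal0.
case: mp => [/eqP|mp]; first by rewrite (negPf p0).
have [g gs_g leg] := redP p Ip p0; have [Ig g0] := gsP g gs_g.
pose q := (p@_(mlead p) / g@_(mlead g)) *: 'X_[mlead p - mlead g] : P.
have c0 : p@_(mlead p) / g@_(mlead g) != 0.
  by rewrite mulf_neq0 ?invr_eq0 ?mleadc_eq0.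
have q0 : q != 0.
  by rewrite -mleadc_eq0 mleadZ_proper ?mcoeffZ mleadXm mcoeffX eqxx mulr1.
have mq : mlead q = (mlead p - mlead g)%MM.
  by rewrite mleadZ_proper mleadXm // mcoeffX eqxx mulr1.
have mqg : mlead (q * g) = mlead p.
  rewrite mleadM_proper ?mq ?submK // mulf_neq0 ?mleadc_eq0 //.
  by rewrite -mq mleadc_eq0.
rewrite -[p](subrK (q * g)); apply: in_idealD; last first.
  by apply: in_idealM; apply: in_ideal_gen.
have [r0|r0] := eqVneq (p - q * g) 0; first by rewrite r0; apply: in_ideal0.
apply: (IH (mlead (p - q * g))); [|by right|exact/IB/IM].
rewrite -mp lt_neqAle; apply/andP; split; last first.
  by apply: le_trans (mleadB_le _ _) _; rewrite mqg joinxx.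
(* If the leading monomial survived, its coefficient in [p - q * g] would be nonzero, but [q] is
   chosen to cancel it. *)
apply: contra r0 => /eqP e; rewrite -mleadc_eq0 e mcoeffB.
have -> : (q * g)@_(mlead p) = p@_(mlead p).
  rewrite -{1}mqg mleadM_proper ?mleadcM; last first.
    by rewrite mulf_neq0 ?mleadc_eq0.
  rewrite mq mcoeffZ mcoeffX eqxx mulr1 divfK // mleadc_eq0 //.
by rewrite subrr.
Qed.

(** The generators lie in [T] itself: a Groebner basis [s] of the ideal generated by [T] exists by
    Dickson's lemma, and each of its finitely many elements involves finitely many members of
    [T]. *)
Theorem hilbert_basis T : exists gs,
  [/\ uniq gs, forall g, g \in gs -> T g &
   forall t, T t -> exists c : P -> P, t = \sum_(g <- gs) c g * g].
Proof.
pose I p := exists2 gs, (forall g, g \in gs -> T g) & in_ideal gs p.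
have catT gs1 gs2 : (forall g, g \in gs1 -> T g) -> (forall g, g \in gs2 -> T g) ->
    forall g, g \in gs1 ++ gs2 -> T g.
  by move=> T1 T2 g; rewrite mem_cat => /orP[/T1|/T2].
have catI gs1 gs2 p : in_ideal gs1 p \/ in_ideal gs2 p -> in_ideal (gs1 ++ gs2) p.
  by case; apply: in_ideal_trans => g gs_g; apply: in_ideal_gen;
    rewrite mem_cat gs_g ?orbT.
have IM p q : I q -> I (p * q).
  by move=> [gs gsT gsq]; exists gs => //; apply: in_idealM.
have IB p q : I p -> I q -> I (p - q).
  move=> [gs1 gs1T p1] /(IM (-1))[gs2 gs2T]; rewrite mulN1r => q2.
  exists (gs1 ++ gs2); first exact: catT.
  by apply: in_idealD; apply: catI; [left|right].
have [s [sI sred]] : exists s : seq P, (forall g, g \in s -> I g /\ g != 0) /\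
    forall p, I p -> p != 0 -> exists2 g, g \in s & (mlead g <= mlead p)%MM.
  apply: contrapT => /forallNP nos.
  have /choice[F FP] : forall s : seq P, exists p,
      (forall g, g \in s -> I g /\ g != 0) ->
      [/\ I p, p != 0 & forall g, g \in s -> ~~ (mlead g <= mlead p)%MM].
    move=> s; have [sI|] := pselect (forall g, g \in s -> I g /\ g != 0); last first.
      by exists 0.
    have /not_andP[//|/existsNP[p]] := nos s.
    move=> /not_implyP[Ip] /not_implyP[p0 pP]; exists p => _; split=> // g s_g.
    by apply/negP => leg; apply: pP; exists g.
  (* Without a finite [s], one adjoins forever polynomials whose leading monomials are multiples of
     no earlier one, against Dickson's lemma. *)
  pose S i := iter i (fun s => F s :: s) [::].
  have SP i : forall g, g \in S i -> I g /\ g != 0.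
    elim: i => //= i IH g; rewrite inE => /predU1P[->|/IH//].
    by have [] := FP _ IH.
  have Smem i j : (i < j)%N -> F (S i) \in S j.
    elim: j => // j IH; rewrite ltnS leq_eqVlt /= inE => /predU1P[->|/IH->].
      by rewrite eqxx.
    by rewrite orbT.
  have [i [j [ij]]] := dickson (fun i => mlead (F (S i))).
  by have [_ _ /(_ _ (Smem _ _ ij))/negPf->] := FP _ (SP j).
have [gs gsT sgs] : exists2 gs, (forall g, g \in gs -> T g) &
    forall g, g \in s -> in_ideal gs g.
  have {sI sred} : forall g, g \in s -> I g by move=> g /sI[].
  elim: s => [|g s IH] sI; first by exists [::].
  have [|gs gsT sgs] := IH; first by move=> h sh; apply: sI; rewrite inE sh orbT.
  have [|gs' gsT' ggs] := sI g; first by rewrite inE eqxx.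
  exists (gs' ++ gs); first exact: catT.
  move=> h; rewrite inE => /predU1P[->|/sgs hh]; apply: catI; [by left|by right].
exists (undup gs); split; first exact: undup_uniq.
  by move=> g; rewrite mem_undup => /gsT.
move=> t Tt.
have It : I t.
  by exists [:: t] => [g|]; [rewrite inE => /eqP->|apply: in_ideal_gen; rewrite inE].
by have := in_ideal_trans sgs (in_ideal_mlead IB IM sI sred It).
Qed.

End Hilbert.

(** * Locally nilpotent derivations *)

Lemma derivation1 (K : fieldType) (A : algType K) (D : A -> A) :
  derivation D -> D 1 = 0.
Proof.
move=> [_ /(_ 1 1)]; rewrite !mulr1 mul1r => /eqP.
by rewrite -[X in X == _]addr0 (inj_eq (addrI _)) eq_sym => /eqP.
Qed.

Section LocallyNilpotent.
Variables (K : fieldType) (A : comAlgType K) (D : A -> A).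
Hypothesis DD : derivation D.

Let DDD f g : D (f + g) = D f + D g.
Proof. by have := DD.1 1 f g; rewrite !scale1r. Qed.
Let D0 : D 0 = 0.
Proof. by apply: (addrI (D 0)); rewrite -DDD !addr0. Qed.

Definition nil_at p := exists k, iter k D p = 0.

Lemma iter_derivation0 k : iter k D 0 = 0.
Proof. by elim: k => //= k ->. Qed.

Lemma iter_derivationD k p q : iter k D (p + q) = iter k D p + iter k D q.
Proof. by elim: k => //= k ->. Qed.

Lemma iter_derivation_eq0 k l p : (k <= l)%N -> iter k D p = 0 -> iter l D p = 0.
Proof. by move=> /subnK<- kp; rewrite iterD kp iter_derivation0. Qed.

(** By the Leibniz rule D (p q) is a sum of two products, each with one of the two bounds lowered;
    induction on a + b replaces the binomial expansion. *)
Lemma iter_derivationM a b p q :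
  iter a D p = 0 -> iter b D q = 0 -> iter (a + b) D (p * q) = 0.
Proof.
have [n] := ubnP (a + b); elim: n a b p q => // n IH [|a] [|b] p q.
- by move=> _ /= -> _; rewrite mul0r.
- by move=> _ /= -> _; rewrite mul0r iter_derivation0.
- by move=> _ _ /= ->; rewrite mulr0 iter_derivation0.
rewrite addSn ltnS => ab pa qb; rewrite iterSr DD.2 iter_derivationD.
rewrite [X in X + _]IH ?add0r -?iterSr ?addSnnS //.
by rewrite -addSnnS IH -?iterSr // addSnnS.
Qed.

Lemma nil_atD p q : nil_at p -> nil_at q -> nil_at (p + q).
Proof.
move=> [a pa] [b qb]; exists (maxn a b); rewrite iter_derivationD.
rewrite (iter_derivation_eq0 (leq_maxl a b)) //.
by rewrite (iter_derivation_eq0 (leq_maxr a b)) // addr0.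
Qed.

Lemma nil_atM p q : nil_at p -> nil_at q -> nil_at (p * q).
Proof. by move=> [a pa] [b qb]; exists (a + b)%N; apply: iter_derivationM. Qed.

Lemma nil_at1 : nil_at 1. Proof. by exists 1%N; exact: derivation1 DD. Qed.

Lemma nil_atZ c p : nil_at p -> nil_at (c *: p).
Proof.
move=> [a pa]; exists a; elim: a p pa => [p /= ->|a IH p]; first by rewrite scaler0.
by rewrite !iterSr; have := DD.1 c p 0; rewrite D0 !addr0 => -> /IH.
Qed.

End LocallyNilpotent.

(** * Linear forms and the derivations defined by matrices *)

Section LinearForms.
Variable K : fieldType.

Definition linform n (v : 'cV[K]_n) : {mpoly K[n]} := \sum_i v i 0 *: 'X_i.

Fact linform_is_linear n : linear (@linform n).
Proof.
move=> c u v; rewrite /linform scaler_sumr -big_split; apply: eq_bigr => i _ /=.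
by rewrite !mxE scalerDl scalerA.
Qed.
HB.instance Definition _ n := GRing.isLinear.Build K 'cV[K]_n {mpoly K[n]} _
  (@linform n) (@linform_is_linear n).

Lemma linform_mulmx m n (M : 'M[K]_(m, n)) v :
  linform (M *m v) = \sum_i v i 0 *: linform (col i M).
Proof.
under [RHS]eq_bigr do rewrite /linform scaler_sumr.
rewrite exchange_big; apply: eq_bigr => i _ /=.
rewrite mxE scaler_suml; apply: eq_bigr => j _.
by rewrite mxE scalerA mulrC.
Qed.

Lemma mcoeff_linform n (v : 'cV[K]_n) i : (linform v)@_U_(i) = v i 0.
Proof.
rewrite /linform linear_sum (bigD1 i) //= big1 => [|j /negPf ji].
  by rewrite mcoeffZ mcoeffXU eqxx mulr1 addr0.
by rewrite mcoeffZ mcoeffXU ji mulr0.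
Qed.

End LinearForms.

Section MpolyGeneration.
Variables (K : fieldType) (n : nat).
Notation P := {mpoly K[n]}.

Lemma mpoly_gen_ind (Q : P -> Prop) :
  (forall p q, Q p -> Q q -> Q (p + q)) -> (forall c p, Q p -> Q (c *: p)) ->
  (forall p q, Q p -> Q q -> Q (p * q)) -> Q 1 -> (forall i, Q 'X_i) ->
  forall p, Q p.
Proof.
move=> QD QZ QM Q1 QX; elim/mpolyind => [|c m p _ _ Qp].
  by rewrite -[0](scale0r 1); apply: QZ.
apply: QD => //; apply: QZ; rewrite mpolyXE_id.
apply: (big_ind Q Q1 QM) => k _; elim: (m k) => [|j IH]; first by rewrite expr0.
by rewrite exprS; apply: QM.
Qed.

(** With [phi] the identity, this identifies derivations by their values on the variables; with
    [phi] a substitution, it shows that the substitution intertwines two derivations. *)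
Lemma derivation_ext (S : lalgType K) (phi D1 D2 : P -> S) :
  phi 1 = 1 -> linear D1 -> linear D2 ->
  (forall p q, D1 (p * q) = D1 p * phi q + phi p * D1 q) ->
  (forall p q, D2 (p * q) = D2 p * phi q + phi p * D2 q) ->
  (forall i, D1 'X_i = D2 'X_i) -> D1 =1 D2.
Proof.
move=> phi1 L1 L2 M1 M2 e.
have D1_0 (D : P -> S) : (forall p q, D (p * q) = D p * phi q + phi p * D q) -> D 1 = 0.
  move=> /(_ 1 1); rewrite !mulr1 phi1 mulr1 mul1r => /eqP.
  by rewrite -[X in X == _]addr0 (inj_eq (addrI _)) eq_sym => /eqP.
have D00 (D : P -> S) : linear D -> D 0 = 0.
  by move=> L; have := L (-1) 0 0; rewrite scaler0 addr0 scaleN1r addNr.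
apply: mpoly_gen_ind => // [p q e1 e2|c p e1|p q e1 e2|].
- by have := L1 1 p q; have := L2 1 p q; rewrite !scale1r e1 e2 => -> ->.
- by have := L1 c p 0; have := L2 c p 0; rewrite !addr0 !D00 // !addr0 e1 => -> ->.
- by rewrite M1 M2 e1 e2.
- by rewrite !D1_0.
Qed.

(** The action of gl_n on the symmetric algebra: the derivation extending the endomorphism [A] of
    the space of linear forms. *)
Definition lder (A : 'M[K]_n) (p : P) : P := \sum_j p^`M(j) * linform (col j A).

Fact lder_is_linear A : linear (lder A).
Proof.
move=> c p q; rewrite /lder scaler_sumr -big_split; apply: eq_bigr => j _ /=.
by rewrite linearP mulrDl scalerAl.
Qed.
HB.instance Definition _ A := GRing.isLinear.Build K P P _ (lder A)
  (lder_is_linear A).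

Lemma lderM A p q : lder A (p * q) = lder A p * q + p * lder A q.
Proof.
rewrite /lder mulr_suml mulr_sumr -big_split; apply: eq_bigr => j _ /=.
by rewrite mderivM mulrDl mulrAC mulrA.
Qed.

Lemma lder_derivation A : derivation (lder A).
Proof. by split; [exact: linearP | exact: lderM]. Qed.

Lemma lderX A j : lder A 'X_j = linform (col j A).
Proof.
rewrite /lder (bigD1 j) //= big1 ?addr0.
  rewrite mderivX mnm1E eqxx scale1r.
  have -> : (U_(j) - U_(j) = 0)%MM by apply/mnmP => i; rewrite mnmBE subnn mnm0E.
  by rewrite mpolyX0 mul1r.
by move=> k /negPf kj; rewrite mderivX mnm1E eq_sym kj scale0r mul0r.
Qed.

Lemma lder_linform A v : lder A (linform v) = linform (A *m v).
Proof.
rewrite linform_mulmx linear_sum; apply: eq_bigr => i _ /=.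
by rewrite linearZ /= lderX.
Qed.

Lemma lder_comm A B p :
  lder A (lder B p) - lder B (lder A p) = lder (A *m B - B *m A) p.
Proof.
move: p; apply: (@derivation_ext _ id) => // [c p q|c p q|p q|p q|j].
- by rewrite !lder_is_linear scalerBr opprD addrACA.
- exact: lder_is_linear.
- by rewrite !lderM !raddfD /= !lderM; ring.
- exact: lderM.
- by rewrite !lderX !lder_linform !colE !mulmxA mulmxBl linearB.
Qed.

Lemma iter_lderX A k j : iter k (lder A) 'X_j = linform (col j (A ^+ k)).
Proof.
elim: k => [|k IH]; last by rewrite iterS IH lder_linform !colE mulmxA mulmxE -exprS.
rewrite expr0 /linform (bigD1 j) //= big1 ?addr0 ?mxE ?eqxx ?scale1r // => i ij.
by rewrite !mxE (negPf ij) scale0r.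
Qed.

Lemma lder_nil A : (exists k, A ^+ k = 0) -> forall p, nil_at (lder A) p.
Proof.
move=> [k Ak]; have DA := lder_derivation A.
apply: mpoly_gen_ind => [p q|c p|p q||i].
- exact: nil_atD.
- exact: nil_atZ.
- exact: nil_atM.
- exact: nil_at1.
- by exists k; rewrite iter_lderX Ak colE mul0mx linear0.
Qed.

End MpolyGeneration.

(** * Weight decomposition under a diagonal derivation *)

Section Weights.
Variables (K : fieldType) (n : nat) (mu : 'rV[K]_n).
Notation P := {mpoly K[n]}.
Notation h := (lder (diag_mx mu)).

Definition wt (m : 'X_{1..n}) : K := \sum_i mu 0 i *+ m i.

Lemma linform_col_diag j : linform (col j (diag_mx mu)) = mu 0 j *: 'X_j :> P.
Proof.
rewrite /linform (bigD1 j) //= big1 ?addr0 ?mxE ?eqxx //.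
by move=> i /negPf ij; rewrite !mxE ij mulr0n scale0r.
Qed.

Lemma lder_diagX m : h 'X_[m] = wt m *: 'X_[m].
Proof.
rewrite /lder /wt scaler_suml; apply: eq_bigr => j _.
rewrite linform_col_diag mderivX -scalerAl -scalerAr scalerA mulr_natl -mpolyXD.
by case E: (m j) => [|k]; rewrite ?mulr0n ?scale0r // submK // lep1mP E.
Qed.

Lemma mcoeff_lder_diag p m : (h p)@_m = wt m * p@_m.
Proof.
elim/mpolyind: p => [|c l p _ _ IH]; first by rewrite linear0 !mcoeff0 mulr0.
rewrite linearP /= mcoeffD IH lder_diagX scalerA !mcoeffD !mcoeffZ mcoeffX mulrDr.
by congr (_ + _); have [->|] := eqVneq l m; rewrite ?mulr0 // mulr1 mulrC mulr1.
Qed.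

Definition wproj w p : P := \sum_(m <- msupp p | wt m == w) p@_m *: 'X_[m].

Lemma mcoeff_wproj w p m : (wproj w p)@_m = if wt m == w then p@_m else 0.
Proof.
rewrite /wproj linear_sum /=; have [pm|pm] := boolP (m \in msupp p); last first.
  rewrite (memN_msupp_eq0 pm) if_same big1_seq // => l /andP[_ pl].
  rewrite mcoeffZ mcoeffX; have [e|] := eqVneq l m; last by rewrite mulr0.
  by rewrite -e pl in pm.
rewrite big_mkcond (bigD1_seq m) ?msupp_uniq //= big1 ?addr0.
  by case: ifP => _; rewrite ?mcoeff0 // mcoeffZ mcoeffX eqxx mulr1.
move=> l /negPf lm; case: ifP => _; rewrite ?mcoeff0 //.
by rewrite mcoeffZ mcoeffX lm mulr0.
Qed.

Fact wproj_is_linear w : linear (wproj w).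
Proof.
move=> c p q; apply/mpolyP => m; rewrite mcoeffD mcoeffZ !mcoeff_wproj.
by case: ifP => _; rewrite ?mcoeffD ?mcoeffZ ?mulr0 ?addr0.
Qed.
HB.instance Definition _ w := GRing.isLinear.Build K P P _ (wproj w)
  (wproj_is_linear w).

Lemma wproj_eigen w p : h (wproj w p) = w *: wproj w p.
Proof.
apply/mpolyP => m; rewrite mcoeff_lder_diag mcoeffZ mcoeff_wproj.
by case: eqP => [->|]; rewrite ?mulr0.
Qed.

Lemma eigen_wproj w w' p : h p = w *: p -> wproj w' p = if w == w' then p else 0.
Proof.
move=> /mpolyP hp; apply/mpolyP => m; rewrite mcoeff_wproj.
have /eqP := hp m; rewrite mcoeff_lder_diag mcoeffZ -subr_eq0 -mulrBl mulf_eq0.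
rewrite subr_eq0 => /orP[/eqP->|/eqP p0]; first by case: eqP; rewrite ?mcoeff0.
by rewrite p0 if_same; case: eqP; rewrite ?mcoeff0.
Qed.

Lemma wproj_sum p : exists2 s, uniq s & p = \sum_(w <- s) wproj w p.
Proof.
exists (undup [seq wt m | m <- msupp p]); first exact: undup_uniq.
apply/mpolyP => m; rewrite linear_sum /=.
have [pm|pm] := boolP (m \in msupp p); last first.
  rewrite memN_msupp_eq0 // big1 // => w _.
  by rewrite mcoeff_wproj memN_msupp_eq0 ?if_same.
rewrite (bigD1_seq (wt m)) ?undup_uniq ?mem_undup ?map_f //=.
rewrite mcoeff_wproj eqxx big1 ?addr0 // => w /negPf wm.
by rewrite mcoeff_wproj eq_sym wm.
Qed.

(** Both sides are additive, so [p] may be replaced by its weight components, whose weights [T]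
    shifts by [a]. *)
Lemma linear_eigen_wproj (T : {linear P -> P}) (a : K) :
  (forall w p, h p = w *: p -> h (T p) = (w + a) *: T p) ->
  forall w p, wproj (w + a) (T p) = T (wproj w p).
Proof.
move=> hT w p; have [s _ ps] := wproj_sum p.
have -> : wproj w p = \sum_(w' <- s) wproj w (wproj w' p).
  by rewrite {1}ps linear_sum.
rewrite {1}ps !linear_sum /=; apply: eq_bigr => w' _.
rewrite (eigen_wproj _ (hT _ _ (wproj_eigen w' p))).
rewrite (eigen_wproj _ (wproj_eigen w' p)) (inj_eq (addIr a)).
by case: eqP => _; rewrite ?linear0.
Qed.

End Weights.

(** * Highest weight vectors and the extremal projector of sl_2 *)

Section Sl2Module.
Variables (K : fieldType) (V : lmodType K) (e f h : {linear V -> V}).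
Hypothesis pcharK : [pchar K] =i pred0.
Hypothesis he : forall v, h (e v) = e (h v) + 2%:R *: e v.
Hypothesis hf : forall v, h (f v) = f (h v) - 2%:R *: f v.
Hypothesis ef : forall v, e (f v) = f (e v) + h v.

Lemma natr_neq0 k : (k.+1%:R : K) != 0.
Proof. by have /pcharf0P -> := pcharK. Qed.

Lemma iter_linear0 (g : {linear V -> V}) k : iter k g 0 = 0.
Proof. by elim: k => //= k ->; rewrite linear0. Qed.

Lemma weight_iter_e a v k :
  h v = a *: v -> h (iter k e v) = (a + (2 * k)%:R) *: iter k e v.
Proof.
move=> hv; elim: k => [|k IH]; first by rewrite muln0 addr0.
rewrite iterS he IH linearZ /= -scalerDl; congr (_ *: _).
by rewrite mulnS natrD; ring.
Qed.

Lemma weight_iter_f a v k :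
  h v = a *: v -> h (iter k f v) = (a - (2 * k)%:R) *: iter k f v.
Proof.
move=> hv; elim: k => [|k IH]; first by rewrite muln0 subr0.
rewrite iterS hf IH linearZ /= -scalerBl; congr (_ *: _).
by rewrite mulnS natrD; ring.
Qed.

Lemma e_iter_f a v k : h v = a *: v ->
  e (iter k.+1 f v) = iter k.+1 f (e v) + (k.+1%:R * (a - k%:R)) *: iter k f v.
Proof.
move=> hv; elim: k => [|k IH]; first by rewrite /= ef hv mul1r subr0.
rewrite iterS ef IH (weight_iter_f _ hv) linearD linearZ /= -addrA -scalerDl.
by congr (_ + _ *: _); rewrite mulnS natrD; ring.
Qed.

(** Here e f^(n+1) v = (n+1)(a - n) f^n v. Descending from a vanishing power of [f], either a = n or
    f^n v already vanishes. *)
Lemma highest_weight_nat a v : h v = a *: v -> e v = 0 ->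
  (exists n, iter n f v = 0) ->
  v = 0 \/ exists2 k : nat, a = k%:R & iter k.+1 f v = 0.
Proof.
move=> hv ev; have [->|v0] := eqVneq v 0; first by left.
move=> [n fn]; right; elim: n fn => [/= v00|n IH fn].
  by rewrite v00 eqxx in v0.
have := e_iter_f n hv; rewrite fn ev linear0 iter_linear0 add0r => /esym/eqP.
rewrite scaler_eq0 mulf_eq0 (negPf (natr_neq0 n)) subr_eq0 /=.
by case/orP => /eqP; [exists n | exact: IH].
Qed.

Lemma highest_weight0 v :
  h v = 0 -> e v = 0 -> (exists n, iter n f v = 0) -> f v = 0.
Proof.
move=> hv ev fv.
have hv0 : h v = 0 *: v by rewrite scale0r.
case: (highest_weight_nat hv0 ev fv) => [->|[k /esym/eqP]]; first exact: linear0.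
by case: k => // k; rewrite (negPf (natr_neq0 k)).
Qed.

(* The coefficients of the extremal projector of sl_2, on the zero weight space. *)
Definition extremal_coef k : K := (-1) ^+ k / (k`! * k.+1`!)%:R.

Definition extremal n v := \sum_(k < n) extremal_coef k *: iter k f (iter k e v).

(** As e^(k+1) v has weight 2(k+1), moving e across f^(k+1) leaves the factor (k+1)(k+2); this
    recursion cancels it against the preceding term. *)
Lemma extremal_coefS k :
  extremal_coef k + extremal_coef k.+1 * (k.+1%:R * k.+2%:R) = 0.
Proof.
rewrite /extremal_coef !factS !natrM exprS.
have fact_neq0 : (k`!%:R : K) != 0.
  by case: (k`!) (fact_gt0 k) => // l _; exact: natr_neq0.
field.
by rewrite fact_neq0 -[1]/1%:R -!natrD !natr_neq0.
Qed.

Lemma h_extremal n v : h v = 0 -> h (extremal n v) = 0.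
Proof.
move=> hv; rewrite /extremal linear_sum big1 // => k _.
have hv0 : h v = 0 *: v by rewrite scale0r.
rewrite linearZ /= (weight_iter_f _ (weight_iter_e _ hv0)) add0r subrr.
by rewrite scale0r scaler0.
Qed.

(** The sum telescopes: with c_m the m-th coefficient, e maps the first m+1 terms to c_m f^m e^(m+1)
    v, which vanishes for m + 1 = n. *)
Lemma e_extremal n v : h v = 0 -> iter n e v = 0 -> e (extremal n v) = 0.
Proof.
move=> hv en; have hv0 : h v = 0 *: v by rewrite scale0r.
suff tele m : e (extremal m.+1 v) =
    extremal_coef m *: iter m f (iter m.+1 e v).
  case: n en => [/= v0|n en]; first by rewrite v0 /extremal big_ord0 linear0.
  by rewrite tele en iter_linear0 scaler0.
elim: m => [|m IH].
  by rewrite /extremal big_ord1 linearZ.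
rewrite /extremal big_ord_recr /= linearD -/(extremal m.+1 v) IH linearZ /= -iterS.
rewrite (e_iter_f _ (weight_iter_e m.+1 hv0)) scalerDr addrCA scalerA.
rewrite -[X in _ + X]scalerDl -[RHS]addr0; congr (_ + _).
rewrite -(scale0r (iter m f (iter m.+1 e v))); congr (_ *: _).
by rewrite -[RHS](extremal_coefS m) add0r natrM; ring.
Qed.

End Sl2Module.

(** * Nilpotent matrices and sl_2-triples *)

Section Sl2Triples.
Variable K : fieldType.

Definition nilmx n (A : 'M[K]_n) := exists k, A ^+ k = 0.

(** The semisimple element is diagonal, so that monomials are weight vectors; nilpotency of [E] and
    [F] makes their derivations locally nilpotent. *)
Definition sl2_triple n (E F : 'M[K]_n) (mu : 'rV[K]_n) :=
  [/\ diag_mx mu *m E - E *m diag_mx mu = 2%:R *: E,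
      diag_mx mu *m F - F *m diag_mx mu = - 2%:R *: F,
      E *m F - F *m E = diag_mx mu, nilmx E & nilmx F].

Lemma expr_block_diag n1 n2 (A : 'M[K]_n1) (B : 'M[K]_n2) k :
  (block_mx A 0 0 B) ^+ k = block_mx (A ^+ k) 0 0 (B ^+ k).
Proof.
elim: k => [|k IH]; first by rewrite !expr0 -scalar_mx_block.
by rewrite !exprS IH -!mulmxE mulmx_block !mulmx0 !mul0mx !addr0 add0r.
Qed.

Lemma nilmx_block n1 n2 (A : 'M[K]_n1) (B : 'M[K]_n2) :
  nilmx A -> nilmx B -> nilmx (block_mx A 0 0 B).
Proof.
move=> [k Ak] [l Bl]; exists (k + l)%N.
by rewrite expr_block_diag !exprD Ak Bl mul0r mulr0 block_mx_const.
Qed.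

Lemma sl2_triple_block n1 n2 (E1 F1 : 'M[K]_n1) mu1 (E2 F2 : 'M[K]_n2) mu2 :
  sl2_triple E1 F1 mu1 -> sl2_triple E2 F2 mu2 ->
  sl2_triple (block_mx E1 0 0 E2) (block_mx F1 0 0 F2) (row_mx mu1 mu2).
Proof.
move=> [e1 f1 h1 nE1 nF1] [e2 f2 h2 nE2 nF2].
split; try exact: nilmx_block.
all: rewrite ?diag_mx_row !mulmx_block !mulmx0 !mul0mx !addr0 !add0r.
all: rewrite opp_block_mx add_block_mx ?scale_block_mx !oppr0 !addr0 ?scaler0.
- by rewrite e1 e2.
- by rewrite f1 f2.
- by rewrite h1 h2.
Qed.

(** Each factor [A] raises [phi] by at least one, so a nonzero entry in column j of A^k forces k <=
    phi j. *)
Lemma nilmx_graded n (A : 'M[K]_n) (phi : 'I_n -> nat) :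
  (forall i j, A i j != 0 -> (phi i < phi j)%N) -> nilmx A.
Proof.
move=> Aphi; exists (\max_i phi i).+1.
suff Ak k i j : (A ^+ k) i j != 0 -> (phi i + k <= phi j)%N.
  apply/matrixP => i j; rewrite mxE; apply/eqP/negPn/negP => /Ak.
  by move=> /(leq_trans (leq_addl _ _)); rewrite ltnNge leq_bigmax.
elim: k i => [|k IH] i.
  by rewrite expr0 mxE addn0; case: (i =P j) => [->//|_]; rewrite eqxx.
rewrite exprS mxE => /eqP nz.
have [l nzl] : exists l, A i l * (A ^+ k) l j != 0.
  apply: contrapT => /forallNP z; apply: nz; apply: big1 => l _.
  exact/eqP/negPn/negP/z.
move: nzl; rewrite mulf_eq0 negb_or => /andP[/Aphi il /IH lj].
by rewrite addnS -addSn (leq_trans _ lj) // leq_add2r.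
Qed.

Definition jordan_block m : 'M[K]_m.+1 := \matrix_(i, j) (j == i.+1 :> nat)%:R.

(** The lowering operator of the irreducible module of dimension m + 1, in the basis where the
    raising operator has entries 1. *)
Definition lower_block m : 'M[K]_m.+1 :=
  \matrix_(i, j) ((i == j.+1 :> nat) * (j.+1 * (m - j)))%:R.

Definition weight_row m : 'rV[K]_m.+1 := \row_i (m%:R - (2 * i)%:R).

Lemma sl2_triple_jordan_block m :
  sl2_triple (jordan_block m) (lower_block m) (weight_row m).
Proof.
split.
- apply/matrixP => i j; rewrite mul_diag_mx mul_mx_diag !mxE.
  case: eqP => [->|_]; last by rewrite !mulr0 mul0r subrr.
  by rewrite mulnS natrD; ring.
- apply/matrixP => i j; rewrite mul_diag_mx mul_mx_diag !mxE.
  case: eqP => [->|_]; last by rewrite !mulr0 mul0r subrr.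
  by rewrite mulnS natrD; ring.
- apply/matrixP => i k; rewrite [LHS]mxE [X in _ + X]mxE.
  have -> : (jordan_block m *m lower_block m) i k =
      ((i == k :> nat) * (k.+1 * (m - k)))%:R.
    rewrite mxE; have [lt_im|le_mi] := ltnP i.+1 m.+1.
      rewrite (bigD1 (Ordinal lt_im)) //= big1 ?addr0 ?mxE ?eqxx ?mul1r //.
      move=> l /negP il; rewrite !mxE; case: eqP => [e|_]; last by rewrite mul0r.
      by case: il; apply/eqP/val_inj.
    (* The last row of the Jordan block is zero, and so is the claimed entry, through its factor m -
       k. *)
    have im : i = m :> nat by apply/eqP; rewrite eqn_leq -ltnS ltn_ord -ltnS.
    rewrite big1; last first.
      by move=> l _; rewrite !mxE im (ltn_eqF (ltn_ord l)) mul0r.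
    by case: eqP => // ik; rewrite -ik im subnn muln0.
  have -> : (lower_block m *m jordan_block m) i k =
      ((i == k :> nat) * (k * (m.+1 - k)))%:R.
    rewrite mxE; case: k => [[|k] lt_km] /=.
      rewrite big1 ?mul0n ?muln0 // => l _; rewrite !mxE /=.
      by rewrite mulr0.
    rewrite (bigD1 (Ordinal (ltnW lt_km))) //= big1 ?addr0 ?mxE /= ?eqxx ?mulr1 ?subSS //.
    move=> l kl; rewrite [X in _ * X]mxE /= eqSS.
    by rewrite -val_eqE /= eq_sym in kl; rewrite (negPf kl) mulr0.
  rewrite !mxE -val_eqE /=; case: eqP => [->|_]; last by rewrite !mul0n subrr.
  rewrite !mul1n mulr1n; have km : (k <= m)%N by rewrite -ltnS.
  by rewrite !natrM subSn // -!natr1 natrB //; ring.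
- apply: (@nilmx_graded _ _ (@nat_of_ord _)) => i j; rewrite mxE.
  by case: (j =P i.+1 :> nat) => [->|]; rewrite ?eqxx.
- apply: (@nilmx_graded _ _ (fun i => m - i)%N) => i j; rewrite mxE.
  case: (i =P j.+1 :> nat) => [e _|]; last by rewrite eqxx.
  by rewrite e; apply: ltn_sub2l => //; rewrite -ltnS -e.
Qed.


(* The cyclic subspace of a row [v] and a complement of it: if [v A^m l = c <> 0] with
   [m] maximal, the matrix of the [v A^i] is complemented by the common
   kernel of the columns [A^(m-j) l]. *)
Lemma cyclic_splitting n (A : 'M[K]_n) : (0 < n)%N -> nilmx A ->
  exists m k (B : 'M[K]_k) (P : 'M[K]_(m.+1 + k, n)) (Q : 'M[K]_(n, m.+1 + k)),
  [/\ (k < n)%N, nilmx B, P *m Q = 1%:M, Q *m P = 1%:M &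
      P *m A = block_mx (jordan_block m) 0 0 B *m P].
Proof.
move=> n0 [N AN]; have [m [Am nAm]] : exists m, A ^+ m.+1 = 0 /\ A ^+ m != 0.
  elim: N AN => [|N IH AN].
    rewrite expr0 => /matrixP/(_ (Ordinal n0) (Ordinal n0))/eqP.
    by rewrite !mxE eqxx oner_eq0.
  by have [/IH//|] := eqVneq (A ^+ N) 0; exists N.
have [i0 [j0 c0]] : exists i0 j0, (A ^+ m) i0 j0 != 0.
  apply: contrapT => /forallNP z; case/eqP: nAm; apply/matrixP => i j.
  by rewrite mxE; apply/eqP/negPn/negP => nz; apply: (z i); exists j.
have Abig l : (m < l)%N -> A ^+ l = 0.
  by move=> /subnK<-; rewrite exprD Am mulr0.
pose C : 'M[K]_(m.+1, n) := \matrix_(i, a) (A ^+ i) i0 a.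
pose G : 'M[K]_(n, m.+1) := \matrix_(a, j) (A ^+ (m - j)) a j0.
have CG i j : (C *m G) i j = (A ^+ (i + (m - j))) i0 j0.
  by rewrite exprD -mulmxE !mxE; apply: eq_bigr => a _; rewrite !mxE.
(* The entry of A^(i+m-j) at (i0, j0) vanishes for i > j and is nonzero for i = j, so the product is
   triangular with nonzero diagonal. *)
have UCG : C *m G \in unitmx.
  rewrite -unitmx_tr unitmxE det_trig.
    rewrite unitfE; apply/prodf_neq0 => i _; rewrite mxE CG subnKC //.
    by rewrite -ltnS.
  apply/is_trig_mxP => i j ij; rewrite mxE CG Abig ?mxE //.
  have im : (i <= m)%N by rewrite -ltnS.
  by rewrite -(ltn_add2r i) -addnA subnK // addnC ltn_add2r.
pose G' := G *m invmx (C *m G).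
have CG' : C *m G' = 1%:M by rewrite /G' mulmxA mulmxV.
pose k := \rank (kermx G); pose B := row_base (kermx G).
have BG : B *m G = 0.
  by apply/eqP; rewrite -sub_kermx /B eq_row_base.
have BG' : B *m G' = 0 by rewrite /G' mulmxA BG mul0mx.
have freeB : row_free B := row_base_free _.
have subB p (Y : 'M[K]_(p, n)) : Y *m G = 0 -> Y *m pinvmx B *m B = Y.
  by move=> YG; apply: mulmxKpV; rewrite eq_row_base sub_kermx YG.
(* The matrix 1 - G' C projects onto the kernel of [G] along the rows of [C]; [X] records this
   projection in the basis [B]. *)
pose X := (1%:M - G' *m C) *m pinvmx B.
have XB : X *m B = 1%:M - G' *m C.
  apply: subB; rewrite mulmxBl mul1mx /G' -!mulmxA.
  by rewrite [invmx _ *m _]mulVmx // mulmx1 subrr.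
have CA : C *m A = jordan_block m *m C.
  apply/matrixP => i a; have [lt_im|le_mi] := ltnP i.+1 m.+1.
    rewrite [RHS]mxE (bigD1 (Ordinal lt_im)) //= big1 ?addr0.
      rewrite !mxE eqxx mul1r /= exprSr -mulmxE mxE.
      by apply: eq_bigr => b _; rewrite mxE.
    move=> l il; rewrite -val_eqE /= in il.
    by rewrite mxE (negPf il) mul0r.
  have im : i = m :> nat by apply/eqP; rewrite eqn_leq -ltnS ltn_ord -ltnS.
  rewrite [RHS]mxE big1; last first.
    by move=> l _; rewrite mxE im (ltn_eqF (ltn_ord l)) mul0r.
  have := congr1 (fun M : 'M[K]_n => M i0 a) Am.
  rewrite exprSr -mulmxE !mxE => AA; rewrite -[RHS]AA.
  by apply: eq_bigr => b _; rewrite mxE im.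
have BAG : B *m A *m G = 0.
  (* [A] maps column j of [G] to column j - 1, and column 0 to zero, so the kernel of [G] is stable
     under [A]. *)
  pose S : 'M[K]_m.+1 := \matrix_(i, j) (i.+1 == j :> nat)%:R.
  suff AGS : A *m G = G *m S by rewrite -mulmxA AGS mulmxA BG mul0mx.
  apply/matrixP => a j.
  have -> : (A *m G) a j = (A ^+ (m.+1 - j)) a j0.
    rewrite subSn ?(ltnSE (ltn_ord j)) // exprS -mulmxE !mxE.
    by apply: eq_bigr => b _; rewrite mxE.
  rewrite mxE; case: j => [[|j] lt_jm] /=.
    rewrite subn0 Am mxE big1 // => l _; rewrite !mxE /=.
    by rewrite mulr0.
  rewrite (bigD1 (Ordinal (ltnW lt_jm))) //= big1 ?addr0.
    by rewrite !mxE eqxx mulr1 subSS.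
  move=> l jl; rewrite [X in _ * X]mxE /= eqSS.
  by rewrite -val_eqE /= in jl; rewrite (negPf jl) mulr0.
pose B' := B *m A *m pinvmx B.
have B'B : B' *m B = B *m A by apply: subB.
exists m, k, B', (col_mx C B), (row_mx G' X); split.
- rewrite /k mxrank_ker ltn_subrL n0 andbT.
  apply: (@leq_trans (\rank (C *m G))); last exact: mxrankM_maxr.
  by rewrite mxrank_unit.
- exists N; apply: (row_free_inj freeB); rewrite mul0mx.
  rewrite -[RHS](mulmx0 _ B) -AN.
  elim: (N) => [|l IH]; first by rewrite !expr0 mul1mx mulmx1.
  by rewrite exprS -mulmxE -mulmxA IH mulmxA B'B -mulmxA exprS.
- have BX : B *m X = 1%:M.
    apply: (row_free_inj freeB); rewrite -mulmxA XB mulmxBr mulmx1 mulmxA BG'.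
    by rewrite mul0mx subr0 mul1mx.
  have CX : C *m X = 0.
    apply: (row_free_inj freeB); rewrite -mulmxA XB mulmxBr mulmx1 mulmxA CG'.
    by rewrite mul1mx subrr mul0mx.
  by rewrite mul_col_row CG' BG' CX BX -scalar_mx_block.
- by rewrite mul_row_col XB addrC subrK.
- by rewrite mul_col_mx mul_block_col !mul0mx addr0 add0r CA B'B.
Qed.

(** Cyclic blocks are split off one at a time, and each carries the triple of an irreducible module.
    The sizes n and n' agree, though not by conversion, so the change of basis is a pair of mutually
    inverse rectangular matrices. *)
Theorem nilmx_sl2_triple n (A : 'M[K]_n) : nilmx A ->
  exists n' (E F : 'M[K]_n') (mu : 'rV[K]_n')
    (P : 'M[K]_(n', n)) (Q : 'M[K]_(n, n')),
  [/\ sl2_triple E F mu, P *m Q = 1%:M, Q *m P = 1%:M & P *m A = E *m P].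
Proof.
have [N] := ubnP n; elim: N n A => // N IH [|n] A lt_nN nA.
  exists 0%N, 0, 0, 0, 0, 0; split; try by apply/matrixP => -[].
  by split; try (by apply/matrixP => -[]); exists 1%N; apply/matrixP => -[].
have [//|m [k [B [P [Q [lt_kn nB PQ QP PA]]]]]] := @cyclic_splitting _ A _ nA.
have [|n' [E [F [mu [P' [Q' [tr P'Q' Q'P' P'B]]]]]]] := IH k B _ nB.
  exact: leq_trans lt_kn _.
exists (m.+1 + n')%N, (block_mx (jordan_block m) 0 0 E),
  (block_mx (lower_block m) 0 0 F), (row_mx (weight_row m) mu),
  (block_mx (1%:M : 'M_m.+1) 0 0 P' *m P),
  (Q *m block_mx (1%:M : 'M_m.+1) 0 0 Q'); split.
- exact/sl2_triple_block/tr/sl2_triple_jordan_block.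
- rewrite -mulmxA (mulmxA P) PQ mul1mx mulmx_block P'Q' !mulmx0 !mul0mx.
  by rewrite !addr0 add0r mulmx1 -scalar_mx_block.
- rewrite -mulmxA (mulmxA (block_mx _ _ _ Q')) mulmx_block Q'P' !mulmx0 !mul0mx.
  by rewrite !addr0 add0r mulmx1 -scalar_mx_block mul1mx.
- rewrite -mulmxA PA !mulmxA; congr (_ *m _).
  rewrite !mulmx_block !mulmx0 !mul0mx !addr0 !add0r mulmx1 mul1mx.
  by rewrite P'B.
Qed.

End Sl2Triples.

(** * The Reynolds operator and finite generation over the invariants *)

Definition fg_over (R : pzRingType) (S T : R -> Prop) :=
  exists k (g : 'I_k -> R), (forall i, T (g i)) /\
    forall t, T t -> exists c : 'I_k -> R,
      (forall i, S (c i)) /\ t = \sum_i c i * g i.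

Section Reynolds.
Variables (K : fieldType) (n : nat).
Hypothesis pcharK : [pchar K] =i pred0.
Notation P := {mpoly K[n]}.
Variables (E F : 'M[K]_n) (mu : 'rV[K]_n).
Hypothesis tr : sl2_triple E F mu.
Notation e := (lder E).
Notation f := (lder F).
Notation h := (lder (diag_mx mu)).

Lemma lderZ (A : 'M[K]_n) c p : lder (c *: A) p = c *: lder A p.
Proof.
rewrite /lder scaler_sumr; apply: eq_bigr => j _.
rewrite scalerAr -linearZ /=; congr (_ * linform _).
by apply/matrixP => i k; rewrite !mxE.
Qed.

Lemma lder_he p : h (e p) = e (h p) + 2%:R *: e p.
Proof.
have [HE _ _ _ _] := tr; have := lder_comm (diag_mx mu) E p.
by rewrite HE lderZ => <-; rewrite addrC subrK.
Qed.

Lemma lder_hf p : h (f p) = f (h p) - 2%:R *: f p.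
Proof.
have [_ HF _ _ _] := tr; have := lder_comm (diag_mx mu) F p.
by rewrite HF lderZ scaleNr => <-; rewrite addrC subrK.
Qed.

Lemma lder_ef p : e (f p) = f (e p) + h p.
Proof.
have [_ _ EF _ _] := tr; have := lder_comm E F p.
by rewrite EF => <-; rewrite addrC subrK.
Qed.

(** Vanishing under [f] is a consequence, proved in [invariant_f]. *)
Definition invariant p := e p = 0 /\ h p = 0.

Lemma iter_lder_mulr (A : 'M[K]_n) k a g :
  lder A g = 0 -> iter k (lder A) (a * g) = iter k (lder A) a * g.
Proof. by move=> g0; elim: k => //= k ->; rewrite lderM g0 mulr0 addr0. Qed.

Lemma wproj_mulr w a g : h g = 0 -> wproj mu w (a * g) = wproj mu w a * g.
Proof.
move=> hg; have [s _ sE] := wproj_sum mu a.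
have -> : wproj mu w a = \sum_(w' <- s) wproj mu w (wproj mu w' a).
  by rewrite {1}sE linear_sum.
rewrite {1}sE !mulr_suml linear_sum; apply: eq_bigr => w' _ /=.
have hag : h (wproj mu w' a * g) = w' *: (wproj mu w' a * g).
  by rewrite lderM hg mulr0 addr0 wproj_eigen scalerAl.
rewrite (eigen_wproj _ hag) (eigen_wproj _ (wproj_eigen _ _ _)).
by case: eqP => _; rewrite ?mul0r.
Qed.

Lemma invariant_f p : invariant p -> f p = 0.
Proof.
move=> [ep hp]; have [_ _ _ _ nF] := tr.
exact: (highest_weight0 pcharK lder_hf lder_ef hp ep (lder_nil nF p)).
Qed.

Lemma iter_lder_eq0 (A : 'M[K]_n) k l p :
  (k <= l)%N -> iter k (lder A) p = 0 -> iter l (lder A) p = 0.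
Proof. exact/iter_derivation_eq0/lder_derivation. Qed.

(** Hilbert's argument: the extremal projector after the zero weight projection is linear over the
    invariants and fixes them, so applying it to an expression of [t] makes the coefficients
    invariant. *)
Theorem invariant_fg (T : P -> Prop) :
  (forall t, T t -> invariant t) -> fg_over invariant T.
Proof.
move=> TI; have [gs [_ gsT gsP]] := hilbert_basis T.
have gT (i : 'I_(size gs)) : T gs`_i by apply/gsT/mem_nth.
exists (size gs), (fun i => gs`_i); split=> // t Tt.
have [et ht] := TI t Tt; have [c tE] := gsP t Tt.
pose c0 g := wproj mu 0 (c g).
have hc0 g : h (c0 g) = 0 by rewrite wproj_eigen scale0r.
have t0E : t = \sum_(i < size gs) c0 gs`_i * gs`_i.
  have -> : t = wproj mu 0 t.
    by rewrite (@eigen_wproj _ _ _ 0) ?eqxx // ht scale0r.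
  rewrite {1}tE linear_sum /= (big_nth 0) big_mkord; apply: eq_bigr => i _.
  by apply: wproj_mulr; case: (TI _ (gT i)).
have [_ _ _ nE _] := tr.
have /choice[b bP] := fun i : 'I_(size gs) => lder_nil nE (c0 gs`_i).
(* One bound serves all coefficients; it is positive, so that [extremal] has its term k = 0, the one
   that fixes invariants. *)
pose N := (\max_i b i).+1.
have nilc (i : 'I_(size gs)) : iter N e (c0 gs`_i) = 0.
  exact: iter_lder_eq0 (leqW (@leq_bigmax _ b i)) (bP i).
exists (fun i => extremal e f N (c0 gs`_i)); split=> [i|].
  split; last exact: (h_extremal lder_he lder_hf _ (hc0 _)).
  exact: (e_extremal pcharK lder_he lder_hf lder_ef (hc0 _) (nilc i)).
have tN : t = extremal e f N t.
  rewrite /extremal /N big_ord_recl /= big1 ?addr0.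
    by rewrite /extremal_coef expr0 !fact0 divr1 scale1r.
  by move=> i _; rewrite -[e (iter _ _ _)]iterS iterSr et !iter_linear0 linear0 scaler0.
rewrite tN /extremal; under [RHS]eq_bigr do rewrite mulr_suml.
rewrite [RHS]exchange_big; apply: eq_bigr => k _ /=.
have iter_sum (D : {linear P -> P}) l (I : finType) (G : I -> P) :
    iter l D (\sum_i G i) = \sum_i iter l D (G i).
  by elim: l => //= l ->; rewrite linear_sum.
rewrite {1}t0E !iter_sum scaler_sumr; apply: eq_bigr => i _.
have Ig := TI _ (gT i); rewrite iter_lder_mulr; last by case: Ig.
by rewrite iter_lder_mulr ?scalerAl //; apply: invariant_f.
Qed.

End Reynolds.

(** * Substitutions and adjoined variables *)

Section Substitution.
Variables (K : fieldType) (n m : nat).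
Implicit Types (x : 'I_n -> {mpoly K[m]}) (p : {mpoly K[n]}).

Definition msubst x p : {mpoly K[m]} := mmap (@mpolyC m K) x p.

Fact msubst_zmod_morphism x : zmod_morphism (msubst x).
Proof. by move=> p q; rewrite /msubst raddfB. Qed.
HB.instance Definition _ x := GRing.isZmodMorphism.Build {mpoly K[n]} {mpoly K[m]}
  (msubst x) (msubst_zmod_morphism x).

Fact msubst_monoid_morphism x : monoid_morphism (msubst x).
Proof. by split=> [|p q]; rewrite /msubst ?rmorph1 ?rmorphM. Qed.
HB.instance Definition _ x := GRing.isMonoidMorphism.Build {mpoly K[n]} {mpoly K[m]}
  (msubst x) (msubst_monoid_morphism x).

Lemma msubstX x i : msubst x 'X_i = x i.
Proof. by rewrite /msubst mmapX mmap1U. Qed.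

Lemma msubstZ x c p : msubst x (c *: p) = c *: msubst x p.
Proof. by rewrite /msubst mmapZ mul_mpolyC. Qed.

Lemma msubst_is_linear x : linear (msubst x).
Proof. by move=> c p q; rewrite rmorphD /= msubstZ. Qed.

Lemma msubst_linform x v : msubst x (linform v) = \sum_i v i 0 *: x i.
Proof.
by rewrite /linform rmorph_sum; apply: eq_bigr => i _ /=; rewrite msubstZ msubstX.
Qed.

Lemma msubst_lder x (A : 'M[K]_n) (D : {mpoly K[m]} -> {mpoly K[m]}) p :
  derivation D -> (forall i, D (x i) = \sum_j A j i *: x j) ->
  D (msubst x p) = msubst x (lder A p).
Proof.
move=> DD Dx; move: p; apply: (@derivation_ext _ _ _ (msubst x)).
- exact: rmorph1.
- by move=> c p q; rewrite msubst_is_linear DD.1.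
- by move=> c p q; rewrite linearP msubst_is_linear.
- by move=> p q; rewrite rmorphM DD.2.
- by move=> p q; rewrite lderM rmorphD !rmorphM.
- move=> i; rewrite msubstX lderX msubst_linform Dx.
  by apply: eq_bigr => j _; rewrite mxE.
Qed.

End Substitution.

Lemma lder_exp (K : fieldType) n (A : 'M[K]_n) p k :
  lder A (p ^+ k.+1) = k.+1%:R *: (p ^+ k * lder A p).
Proof.
elim: k => [|k IH]; first by rewrite expr0 mul1r scale1r.
rewrite exprS lderM IH -scalerAr mulrA -exprS mulrC -[X in X + _]scale1r -scalerDl.
by rewrite nat1r.
Qed.

Section ExtraVariables.
Variables (K : fieldType) (n m : nat).

Definition mincl : {mpoly K[n]} -> {mpoly K[n + m]} :=
  msubst (fun i => 'X_(lshift m i)).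
Definition mres (x : 'I_m -> {mpoly K[n]}) : {mpoly K[n + m]} -> {mpoly K[n]} :=
  msubst (fun k => match split k with inl i => 'X_i | inr j => x j end).

HB.instance Definition _ := GRing.RMorphism.on mincl.
HB.instance Definition _ x := GRing.RMorphism.on (mres x).

Lemma minclZ c p : mincl (c *: p) = c *: mincl p.
Proof. exact: msubstZ. Qed.
Lemma minclX i : mincl 'X_i = 'X_(lshift m i).
Proof. exact: msubstX. Qed.
Lemma mresZ x c p : mres x (c *: p) = c *: mres x p.
Proof. exact: msubstZ. Qed.
Lemma mresX_l x i : mres x 'X_(lshift m i) = 'X_i.
Proof. by rewrite /mres msubstX (unsplitK (inl i)). Qed.
Lemma mresX_r x j : mres x 'X_(rshift n j) = x j.
Proof. by rewrite /mres msubstX (unsplitK (inr j)). Qed.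

Lemma minclK x : cancel mincl (mres x).
Proof.
apply: mpoly_gen_ind => [p q e1 e2|c p e|p q e1 e2||i].
- by rewrite !rmorphD /= e1 e2.
- by rewrite minclZ mresZ e.
- by rewrite !rmorphM /= e1 e2.
- by rewrite !rmorph1.
- by rewrite minclX mresX_l.
Qed.

Variables (A : 'M[K]_n) (B : 'M[K]_m).
Notation AB := (block_mx A 0 0 B).

Lemma lder_block_l p : lder AB (mincl p) = mincl (lder A p).
Proof.
apply: msubst_lder => [|i]; first exact: lder_derivation.
rewrite lderX /linform big_split_ord /= [X in _ + X]big1 ?addr0.
  by apply: eq_bigr => j _; rewrite mxE block_mxEul.
by move=> j _; rewrite mxE block_mxEdl mxE scale0r.
Qed.

Lemma iter_lder_block_l k p :
  iter k (lder AB) (mincl p) = mincl (iter k (lder A) p).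
Proof. by elim: k => //= k ->; rewrite lder_block_l. Qed.

Lemma lder_block_r j :
  lder AB 'X_(rshift n j) = \sum_i B i j *: 'X_(rshift n i).
Proof.
rewrite lderX /linform big_split_ord /= [X in X + _]big1 ?add0r.
  by apply: eq_bigr => i _; rewrite mxE block_mxEdr.
by move=> i _; rewrite mxE block_mxEur mxE scale0r.
Qed.

Lemma mres_lder x p : (forall j, lder A (x j) = \sum_i B i j *: x i) ->
  lder A (mres x p) = mres x (lder AB p).
Proof.
move=> xB; apply: msubst_lder => [|k]; first exact: lder_derivation.
rewrite big_split_ord /=; under eq_bigr do rewrite (unsplitK (inl _)).
under [X in _ + X]eq_bigr do rewrite (unsplitK (inr _)).
case: (split_ordP k) => i ->.
  rewrite lderX /linform [X in _ + X]big1 ?addr0.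
    by apply: eq_bigr => j _; rewrite mxE block_mxEul.
  by move=> j _; rewrite block_mxEdl mxE scale0r.
rewrite xB [X in X + _]big1 ?add0r; last first.
  by move=> j _; rewrite block_mxEur mxE scale0r.
by apply: eq_bigr => j _; rewrite block_mxEdr.
Qed.

End ExtraVariables.

(* Adjoining the natural two-dimensional module, with weight vectors [s] of weight -1 and
   [tau = e s] of weight 1, identifies [ker e] with invariants: [s = 1], [tau = 0]
   restricts an invariant to an element of [ker e], and an element [t] of weight [k]
   of [ker e] is the restriction of [sum_i f^i(t) s^(k-i) (-tau)^i / i!]. *)
Section KernelToInvariants.
Variables (K : fieldType) (n : nat).
Hypothesis pcharK : [pchar K] =i pred0.
Variables (E F : 'M[K]_n) (mu : 'rV[K]_n).
Hypothesis tr : sl2_triple E F mu.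
Notation P := {mpoly K[n]}.
Notation Q := {mpoly K[n + 2]}.
Notation e := (lder E).
Notation f := (lder F).
Notation h := (lder (diag_mx mu)).
Notation E2 := (block_mx E 0 0 (jordan_block K 1)).
Notation F2 := (block_mx F 0 0 (lower_block K 1)).
Notation mu2 := (row_mx mu (weight_row K 1)).
Notation e2 := (lder E2).
Notation h2 := (lder (diag_mx mu2)).

Let tr2 : sl2_triple E2 F2 mu2.
Proof. exact/sl2_triple_block/sl2_triple_jordan_block. Qed.

Let s : Q := 'X_(rshift n 1).
Let tau : Q := 'X_(rshift n 0).
Notation incl := (@mincl K n 2).
Notation res := (@mres K n 2 (fun j => (j == 1)%:R)).

Let lder_pair (A : 'M[K]_n) (B : 'M[K]_2) j :
  lder (block_mx A 0 0 B) 'X_(rshift n j) = B 0 j *: tau + B 1 j *: s.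
Proof.
rewrite lder_block_r big_ord_recl big_ord1.
by congr (_ + B _ _ *: 'X_(rshift n _)); apply: val_inj.
Qed.

Let e2s : e2 s = tau.
Proof. by rewrite lder_pair !mxE /= scale0r scale1r addr0. Qed.

Let e2tau : e2 tau = 0.
Proof. by rewrite lder_pair !mxE /= !scale0r addr0. Qed.

Let h2E : diag_mx mu2 = block_mx (diag_mx mu) 0 0 (diag_mx (weight_row K 1)).
Proof. exact: diag_mx_row. Qed.

Let h2s : h2 s = - s.
Proof.
rewrite h2E lder_pair !mxE /= mulr0n scale0r add0r mulr1n -scaleN1r.
by congr (_ *: _); rewrite muln1; ring.
Qed.

Let h2tau : h2 tau = tau.
Proof.
by rewrite h2E lder_pair !mxE /= mulr0n scale0r addr0 mulr1n subr0 scale1r.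
Qed.

Let res_s : res s = 1. Proof. exact: mresX_r. Qed.
Let res_tau : res tau = 0. Proof. exact: mresX_r. Qed.

(** The values 1 of s and 0 of tau = e s satisfy e 1 = 0 and e 0 = 0, so restriction commutes with
    raising; it does not respect weights. *)
Let res_e2 p : e (res p) = res (e2 p).
Proof.
apply: mres_lder => j; rewrite big_ord_recl big_ord1 !mxE /= scaler0 add0r.
case: j => [[|[|//]] ?] /=; rewrite scale0r; first exact: linear0.
exact: derivation1 (lder_derivation E).
Qed.

Let term t k i := (i`!%:R : K)^-1 *: (incl (iter i f t) * s ^+ (k - i) * (- tau) ^+ i).

Let lift t k := \sum_(i < k.+1) term t k i.

Let res_term c p a b :
  res (c *: (incl p * s ^+ a * (- tau) ^+ b)) = c *: (p * 0 ^+ b).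
Proof.
rewrite mresZ !rmorphM !rmorphXn rmorphN /= minclK res_tau res_s.
by rewrite oppr0 expr1n mulr1.
Qed.

Let res_lift t k : res (lift t k) = t.
Proof.
have -> : res (lift t k) = \sum_(i < k.+1) res (term t k i) by rewrite /lift rmorph_sum.
rewrite big_ord_recl big1 => [|i _]; rewrite res_term.
  by rewrite fact0 invr1 scale1r expr0 mulr1 addr0.
by rewrite expr0n mulr0 scaler0.
Qed.

Lemma weighted_lift t k : e t = 0 -> h t = k%:R *: t ->
  exists2 p, invariant E2 mu2 p & res p = t.
Proof.
move=> et ht; exists (lift t k); last exact: res_lift.
pose a i : Q := (i`!%:R : K)^-1 *: (incl (iter i f t) *
  ((k - i)%:R *: s ^+ (k - i).-1) * (- tau) ^+ i.+1).
have e2sX l : e2 (s ^+ l) = l%:R *: (s ^+ l.-1 * tau).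
  case: l => [|l]; last by rewrite lder_exp e2s.
  by rewrite scale0r; apply: (derivation1 (lder_derivation _)).
have e2tauX l : e2 ((- tau) ^+ l) = 0.
  case: l => [|l]; first exact: (derivation1 (lder_derivation _)).
  by rewrite lder_exp linearN /= e2tau oppr0 mulr0 scaler0.
have e2term i : e2 (term t k i) =
    (i`!%:R : K)^-1 *: (incl (e (iter i f t)) * s ^+ (k - i) * (- tau) ^+ i) - a i.
  rewrite linearZ /= lderM e2tauX mulr0 addr0 lderM lder_block_l e2sX.
  rewrite mulrDl scalerDr; congr (_ + _); rewrite /a -scalerN; congr (_ *: _).
  by rewrite exprS -!scalerAr -!scalerAl -scalerN; congr (_ *: _); ring.
have fact_neq0 i : (i`!%:R : K) != 0.
  by case: (i`!) (fact_gt0 i) => // l _; exact: (natr_neq0 pcharK).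
(* The part [a i] left by differentiating s^(k-i) is cancelled by the next term, as e f^(i+1) t =
   (i+1)(k-i) f^i t; the last one, [a k], has the factor k - k. *)
have e2sum m : (m <= k)%N -> e2 (\sum_(i < m.+1) term t k i) = - a m.
  elim: m => [|m IH] le_mk.
    by rewrite big_ord1 e2term /= et rmorph0 !mul0r scaler0 add0r.
  rewrite big_ord_recr linearD /= IH ?(ltnW le_mk) // e2term.
  rewrite addrA -[RHS]add0r; congr (_ + _).
  rewrite (e_iter_f (lder_hf tr) (lder_ef tr) _ ht) /= et iter_linear0 linear0 add0r.
  rewrite minclZ -!scalerAl scalerA /a addrC -scalerAr -!scalerAl.
  rewrite scalerA -subnS; apply/eqP; rewrite subr_eq0; apply/eqP; congr (_ *: _).
  rewrite factS natrM natrB; last exact: ltnW.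
  by field; rewrite fact_neq0 nat1r (natr_neq0 pcharK).
split.
  by rewrite /lift e2sum // /a subnn scale0r mulr0 mul0r scaler0 oppr0.
have h2sX l : h2 (s ^+ l) = - l%:R *: s ^+ l.
  case: l => [|l].
    by rewrite oppr0 scale0r; exact: (derivation1 (lder_derivation _)).
  by rewrite lder_exp h2s mulrN -exprSr scaleNr scalerN.
have h2tauX l : h2 ((- tau) ^+ l) = l%:R *: (- tau) ^+ l.
  case: l => [|l]; first by rewrite scale0r; exact: (derivation1 (lder_derivation _)).
  by rewrite lder_exp linearN /= h2tau -exprSr.
(* The weights k - 2i of f^i t, -(k - i) of s^(k-i) and i of tau^i add up to zero. *)
rewrite /lift linear_sum big1 // => -[i] /=; rewrite ltnS => le_ik _.
rewrite linearZ /= lderM lderM h2sX h2tauX h2E lder_block_l.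
rewrite (weight_iter_f (lder_hf tr) _ ht) minclZ.
rewrite -!scalerAl -!scalerAr -scalerDl -scalerAl -scalerDl natrB //.
rewrite (_ : _ + _ + _ = 0) ?scale0r ?scaler0 // natrM; ring.
Qed.

(** As [e] shifts weights by 2, the weight components of [t] stay in its kernel; the nonzero ones
    are highest weight vectors of natural weight, and [weighted_lift] applies to each. *)
Lemma kernel_lift t : e t = 0 -> exists2 p, invariant E2 mu2 p & res p = t.
Proof.
move=> et; have [r _ tE] := wproj_sum mu t.
have ew w : e (wproj mu w t) = 0.
  rewrite -(@linear_eigen_wproj _ _ mu e 2%:R) => [|w' p hp] /=.
    by rewrite et linear0.
  by rewrite (lder_he tr) hp linearZ scalerDl.
have [_ _ _ _ nF] := tr.
rewrite tE; elim: {tE} r => [|w r [p [ep hp] pE]].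
  by exists 0; rewrite ?big_nil; [split; exact: linear0 | exact: rmorph0].
have [q [eq hq] qE] : exists2 q, invariant E2 mu2 q & res q = wproj mu w t.
  case: (highest_weight_nat pcharK (lder_hf tr) (lder_ef tr) (wproj_eigen mu w t) (ew w)).
  - exact: lder_nil.
  - by move=> ->; exists 0; [split; exact: linear0 | exact: rmorph0].
  - by move=> [k wk _]; apply: (weighted_lift (ew w) (k := k)); rewrite wproj_eigen wk.
exists (q + p); first by split; rewrite linearD /= ?eq ?ep ?hq ?hp addr0.
by rewrite big_cons -qE -pE rmorphD.
Qed.

(** Generators are taken among the invariants that restrict into [T]; restriction then gives
    identities in [T] with coefficients in the kernel of [e]. *)
Theorem sl2_kernel_fg (T : P -> Prop) :
  (forall t, T t -> e t = 0) -> fg_over (fun p => e p = 0) T.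
Proof.
move=> Te; have [|k [g [gT gP]]] := invariant_fg pcharK tr2
    (T := fun p => invariant E2 mu2 p /\ T (res p)); first by move=> p [].
exists k, (fun i => res (g i)); split=> [i|t Tt]; first by case: (gT i).
have [p ip pt] := kernel_lift (Te t Tt).
have [|c [ci pE]] := gP p; first by rewrite pt.
exists (fun i => res (c i)); split=> [i|]; last first.
  by rewrite -pt pE rmorph_sum; apply: eq_bigr => i _; rewrite rmorphM.
by rewrite res_e2; case: (ci i) => -> _; apply: rmorph0.
Qed.

End KernelToInvariants.

(** The linear change of variables that turns [A] into the raising matrix [E] intertwines the two
    derivations, so finite generation transfers from [E] to [A]. *)
Theorem nilmx_kernel_fg (K : fieldType) (n : nat) (A : 'M[K]_n)
    (T : {mpoly K[n]} -> Prop) : [pchar K] =i pred0 -> nilmx A ->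
  (forall t, T t -> lder A t = 0) -> fg_over (fun p => lder A p = 0) T.
Proof.
move=> pcharK nA TA.
have [n' [E [F [mu [B [C [tr BC CB BA]]]]]]] := nilmx_sl2_triple nA.
have CE : C *m E = A *m C.
  by rewrite -[C *m E]mulmx1 -BC -mulmxA (mulmxA E) -BA !mulmxA CB mul1mx.
pose th : {mpoly K[n]} -> {mpoly K[n']} := msubst (fun j => linform (col j B)).
pose th' : {mpoly K[n']} -> {mpoly K[n]} := msubst (fun j => linform (col j C)).
have lder_subst a b (M : 'M[K]_(b, a)) (X : 'M[K]_a) (Y : 'M[K]_b) p :
    M *m X = Y *m M -> lder Y (msubst (fun j => linform (col j M)) p)
      = msubst (fun j => linform (col j M)) (lder X p).
  move=> MX; apply: msubst_lder => [|i]; first exact: lder_derivation.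
  rewrite lder_linform colE mulmxA -MX -mulmxA -colE linform_mulmx.
  by apply: eq_bigr => j _; rewrite mxE.
have thK p : th' (th p) = p.
  move: p; apply: mpoly_gen_ind => [p q|c p|p q||i].
  - by rewrite /th /th' !rmorphD /= => -> ->.
  - by rewrite /th /th' !msubstZ => ->.
  - by rewrite /th /th' !rmorphM /= => -> ->.
  - by rewrite /th /th' !rmorph1.
  - rewrite /th /th' msubstX msubst_linform -linform_mulmx colE mulmxA CB.
    rewrite mul1mx /linform (bigD1 i) //= big1 ?addr0 ?mxE ?eqxx ?scale1r //.
    by move=> j ji; rewrite !mxE (negPf ji) scale0r.
have [|k [g [gT gP]]] := sl2_kernel_fg pcharK tr
    (T := fun q => lder E q = 0 /\ T (th' q)); first by move=> q [].
exists k, (fun i => th' (g i)); split=> [i|t Tt]; first by case: (gT i).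
have [|c [ci tE]] := gP (th t).
  by rewrite thK /th (lder_subst _ _ _ A) // TA //; split=> //; apply: rmorph0.
exists (fun i => th' (c i)); split=> [i|]; last first.
  by rewrite -[t]thK tE /th' rmorph_sum; apply: eq_bigr => i _; rewrite rmorphM.
by rewrite /th' (lder_subst _ _ _ E) // ci; apply: rmorph0.
Qed.

(** * The Magnus representation of the free metabelian algebra *)

Section MetabGeneration.
Import monalg.
Variables (K : fieldType) (d : nat).
Notation M := (metab K d).

Lemma metab_gen_ind (Q : M -> Prop) :
  (forall f g, Q f -> Q g -> Q (f + g)) -> (forall c f, Q f -> Q (c *: f)) ->
  (forall f g, Q f -> Q g -> Q (f * g)) -> Q 1 -> (forall i, Q (xvar K i)) ->
  forall f, Q f.
Proof.
move=> QD QZ QM Q1 QX f.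
have [g ->] : exists g, f = metab_proj g by exists (repr f); rewrite /metab_proj reprK.
have Q0 : Q 0 by rewrite -(scale0r 1); apply: QZ.
rewrite [g]monalgE raddf_sum; apply: (big_ind Q Q0 QD) => m _ /=.
have -> : mkmalgU m (mcoeff m g) =
    mcoeff m g *: (mkmalgU m 1 : free_alg K d).
  by apply/malgP => k; rewrite mcoeffZ !mcoeffU; case: eqP; rewrite ?mulr1 ?mulr0.
rewrite metab_projZ; apply: QZ; case: m => s.
elim: s => [|i s IH]; first by rewrite -[FMonom _]fmoneE; exact: Q1.
have -> : mkmalgU (FMonom (i :: s)) 1 =
    (mkmalgU (fmu i) 1 : free_alg K d) * mkmalgU (FMonom s) 1.
  rewrite malgM_def fgmulUU mulr1; congr (mkmalgU _ _).
  rewrite fmuE. exact: (esym (fmmulE (FMonom [:: i]) (FMonom s))).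
by rewrite metab_projM; apply: QM => //; exact: QX.
Qed.

End MetabGeneration.

Section MagnusRepresentation.
Import monalg.
Variables (K : fieldType) (d : nat).
Notation A := (free_alg K d).
Notation F := (metab K d).
Notation P := (mpoly (d + d) K).
Notation R := (mpoly (d + d + d) K).
Notation MR := 'M[R]_2.

Let u i : R := mincl d (uvar K i).
Let v i : R := mincl d (vvar K i).
Let y i : R := 'X_(rshift (d + d) i).

(* The Magnus matrix of x_i is [[u_i, y_i], [0, u_i + v_i]]. *)
Definition magnus_gen i : MR :=
  \matrix_(a, b) (if a == b then (if a == 0 then u i else u i + v i)
                  else if a == 0 then y i else 0).

Definition magnus_word (m : fmonom 'I_d) : MR :=
  \prod_(i <- fmonom_val m) magnus_gen i.

Fact magnus_word_mmorphism : mmorphism magnus_word.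
Proof.
split=> [m1 m2|]; rewrite /magnus_word.
  by rewrite -big_cat; have -> : mmul m1 m2 = FMonom (m1 ++ m2) by exact: fmmulE.
have -> : mone = FMonom [::] :> fmonom 'I_d by exact: fmoneE.
by rewrite big_nil.
Qed.
HB.instance Definition _ := isMultiplicative.Build _ _ magnus_word
  magnus_word_mmorphism.

Definition magnus (f : A) : MR :=
  mmap (@scalar_mx R 2 \o @mpoly.mpolyC (d + d + d) K) magnus_word f.

Fact magnus_nmod_morphism : nmod_morphism magnus.
Proof. by split=> [|f g]; rewrite /magnus ?raddf0 ?raddfD. Qed.
HB.instance Definition _ := GRing.isNmodMorphism.Build A MR magnus
  magnus_nmod_morphism.

Fact magnus_monoid_morphism : monoid_morphism magnus.
Proof.
have [|M1 M2] := @commr_mmap_is_multiplicative _ _ _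
   [the {rmorphism K -> MR} of @scalar_mx R 2 \o @mpoly.mpolyC (d + d + d) K] magnus_word.
  by move=> g m m'; exact/esym/scalar_mxC.
by split.
Qed.

HB.instance Definition _ := GRing.isMonoidMorphism.Build A MR magnus
  magnus_monoid_morphism.

Lemma magnusZ c f : magnus (c *: f) = mpoly.mpolyC (d + d + d) c *: magnus f.
Proof.
have -> : c *: f = malgC c * f by rewrite mul_malgC.
rewrite rmorphM /= [X in X * _](_ : _ = (mpoly.mpolyC (d + d + d) c)%:M).
  exact: mul_scalar_mx.
by rewrite /magnus mmapU /= mmorph1 mulr1.
Qed.

Lemma magnusX i : magnus (mkmalgU (fmu i) 1) = magnus_gen i.
Proof. by rewrite /magnus mmapU /= rmorph1 mul1r /magnus_word fmuE big_seq1. Qed.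

Lemma mulmx2 (X Y : MR) a b : (X * Y) a b = X a 0 * Y 0 b + X a 1 * Y 1 b.
Proof.
by rewrite -mulmxE mxE big_ord_recl big_ord1; congr (_ + X _ _ * Y _ _); apply: val_inj.
Qed.

Lemma magnus_lower f : magnus f 1 0 = 0.
Proof.
rewrite /magnus /mmap summxE big1 // => m _.
rewrite mulmx2 /= !mxE /= mul0r add0r mulr1n.
suff -> : magnus_word m 1 0 = 0 by rewrite mulr0.
rewrite /magnus_word; elim: (fmonom_val m) => [|i s IH].
  by rewrite big_nil mxE.
by rewrite big_cons mulmx2 IH mulr0 addr0 !mxE /= mul0r.
Qed.

Lemma diag_mulmx2 (X Y : MR) : X 1 0 = 0 -> Y 1 0 = 0 ->
  ((X * Y) 0 0 = X 0 0 * Y 0 0) * ((X * Y) 1 1 = X 1 1 * Y 1 1).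
Proof. by move=> X0 Y0; rewrite !mulmx2 X0 Y0 mul0r mulr0 addr0 add0r. Qed.

Lemma strict_upper_mulmx2 (X Y : MR) :
  X 0 0 = 0 -> X 1 0 = 0 -> X 1 1 = 0 -> Y 0 0 = 0 -> Y 1 0 = 0 -> Y 1 1 = 0 ->
  X * Y = 0.
Proof.
move=> X00 X10 X11 Y00 Y10 Y11.
have split2 (a : 'I_2) : a = 0 \/ a = 1.
  by case: a => [[|[|//]] ?]; [left|right]; apply: val_inj.
apply/matrixP => a b; rewrite mulmx2 mxE.
case: (split2 a) => ->; case: (split2 b) => ->;
  by rewrite ?X00 ?X10 ?X11 ?Y00 ?Y10 ?Y11 ?mulr0 ?mul0r ?addr0.
Qed.

(** Diagonal entries of upper triangular matrices multiply in the commutative ring [R], so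
    commutators have zero diagonal. *)
Lemma upper_commutator_ideal (S : pzRingType) (phi : {rmorphism S -> MR}) f :
  (forall g, phi g 1 0 = 0) -> commutator_ideal f ->
  phi f 0 0 = 0 /\ phi f 1 1 = 0.
Proof.
move=> lower; have dM g h := diag_mulmx2 (lower g) (lower h).
have mxB (X Y : MR) a b : (X - Y) a b = X a b - Y a b by rewrite !mxE.
have mxD (X Y : MR) a b : (X + Y) a b = X a b + Y a b by rewrite !mxE.
elim=> {f} [_ [f [g ->]]||f g _ [f0 f1] _ [g0 g1]|g f _ [f0 f1]|g f _ [f0 f1]].
- rewrite rmorphB !rmorphM !mxB !dM.
  by split; rewrite [X in X - _]mulrC subrr.
- by rewrite rmorph0 !mxE.
- by rewrite rmorphD !mxD f0 f1 g0 g1 addr0.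
- by rewrite rmorphM !dM f0 f1 !mulr0.
- by rewrite rmorphM !dM f0 f1 !mul0r.
Qed.

(** Products of two elements of the commutator ideal go to products of strictly upper triangular 2
    by 2 matrices. *)
Lemma magnus_metab_ideal f : f \in @metab_ideal K d -> magnus f = 0.
Proof.
move=> /metab_idealP; apply: ideal_gen_ker => _ [f' [g' [fI gI ->]]].
have [[f0 f1] [g0 g1]] := (upper_commutator_ideal magnus_lower fI,
  upper_commutator_ideal magnus_lower gI).
rewrite rmorphM; apply: strict_upper_mulmx2 => //; exact: magnus_lower.
Qed.

(** Taken on a representative; [mag_proj] shows that the choice does not matter. *)
Definition mag a b (f : F) : R := magnus (repr f) a b.

Lemma mag_proj a b g : mag a b (metab_proj g) = magnus g a b.
Proof.
suff /magnus_metab_ideal/eqP : repr (metab_proj g) - g \in @metab_ideal K d.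
  by rewrite rmorphB subr_eq0 /mag => /eqP->.
by rewrite -metab_projP /metab_proj reprK.
Qed.

Let proj_ex (f : F) : exists g, f = metab_proj g.
Proof. by exists (repr f); rewrite /metab_proj reprK. Qed.

Fact mag_is_linear a b c : {morph mag a b : f g / c *: f + g >-> c *: f + g}.
Proof.
move=> f g; have [[f' ->] [g' ->]] := (proj_ex f, proj_ex g).
rewrite -metab_projZ -raddfD !mag_proj raddfD /= magnusZ !mxE.
by rewrite mpoly.mul_mpolyC.
Qed.
HB.instance Definition _ a b := GRing.isLinear.Build K F R _ (mag a b)
  (mag_is_linear a b).

Lemma magM a b f g : mag a b (f * g) = mag a 0 f * mag 0 b g + mag a 1 f * mag 1 b g.
Proof.
have [[f' ->] [g' ->]] := (proj_ex f, proj_ex g).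
by rewrite -metab_projM !mag_proj rmorphM mulmx2.
Qed.

Lemma mag10 f : mag 1 0 f = 0.
Proof. by have [f' ->] := proj_ex f; rewrite mag_proj magnus_lower. Qed.

Lemma mag_xvar a b i : mag a b (xvar K i) = magnus_gen i a b.
Proof. by rewrite mag_proj magnusX. Qed.

Lemma mag1 a b : mag a b 1 = (a == b)%:R.
Proof. by rewrite mag_proj rmorph1 mxE. Qed.

End MagnusRepresentation.

(** * The commutator ideal as a module, and the Koszul homotopy *)

Section MetabelianAlgebra.
Variables (K : fieldType) (d : nat) (A : algType K) (x : 'I_d -> A).
Notation P := {mpoly K[d + d]}.
Notation I := (@commutator_ideal A).
Hypothesis metabelian : forall f g : A, I f -> I g -> f * g = 0.
Implicit Types (f g : A) (p q : P).

Notation act := (act x).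

Lemma actDl p q f : act (p + q) f = act p f + act q f.
Proof. by have := act_linearl x f 1 p q; rewrite !scale1r. Qed.
Lemma actDr p f g : act p (f + g) = act p f + act p g.
Proof. by have := act_linearr x p 1 f g; rewrite !scale1r. Qed.
Lemma act0r p : act p 0 = 0.
Proof. by have := act_linearr x p (-1) 0 0; rewrite scaler0 addr0 scaleN1r addNr. Qed.
Lemma actZl c p f : act (c *: p) f = c *: act p f.
Proof. by have := act_linearl x f c p 0; rewrite act0l !addr0. Qed.
Lemma actZr c p f : act p (c *: f) = c *: act p f.
Proof. by have := act_linearr x p c f 0; rewrite act0r !addr0. Qed.
Lemma actNr p f : act p (- f) = - act p f.
Proof. by rewrite -scaleN1r actZr scaleN1r. Qed.
Lemma act_sum_l (J : finType) (F : J -> P) f : act (\sum_i F i) f = \sum_i act (F i) f.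
Proof. by apply: (big_morph (act^~ f) (fun p q => actDl p q f)); apply: act0l. Qed.
Lemma act_sum_r (J : finType) p (F : J -> A) : act p (\sum_i F i) = \sum_i act p (F i).
Proof. by apply: (big_morph (act p) (actDr p)); apply: act0r. Qed.

Definition comx i j : A := x i * x j - x j * x i.

Lemma comx_ideal i j : I (comx i j).
Proof. by apply: ideal_gen_sub; exists (x i), (x j). Qed.

Lemma actM_comx p q i j : act (p * q) (comx i j) = act p (act q (comx i j)).
Proof. exact/actM/comx_ideal. Qed.

Lemma ideal_sum (J : finType) (F : J -> A) : (forall i, I (F i)) -> I (\sum_i F i).
Proof.
by move=> FI; elim/big_ind: _ => //; [exact: ideal_gen0 | exact: ideal_genD].
Qed.

Lemma comxN i j : comx j i = - comx i j.
Proof. by rewrite /comx opprB. Qed.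

(** This is the Jacobi identity, since v_b acts as f -> [f, x_b]. *)
Lemma comx_jacobi a b k :
  act (vvar K b) (comx k a) - act (vvar K a) (comx k b) = - act (vvar K k) (comx a b).
Proof.
have zmod_id (t1 t2 t3 t4 t5 t6 : A) : t1 - t2 - (t3 - t4) =
    (t1 - t5 - (t6 - t4)) + (t5 - t3 - (t2 - t6)).
  rewrite !opprB [RHS](AC ((2*2)*(2*2)) (((1*8)*(3*6))*((5*2)*(7*4)))).
  by rewrite /= !subrr !addr0.
apply/eqP; rewrite subr_eq !act_v opprB; apply/eqP.
by rewrite /comx !mulrBl !mulrBr !mulrA; apply: zmod_id.
Qed.

Definition span_comx f :=
  exists a : 'I_d -> 'I_d -> P, f = \sum_i \sum_j act (a i j) (comx i j).

Lemma span_comxD f g : span_comx f -> span_comx g -> span_comx (f + g).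
Proof.
move=> [a ->] [b ->]; exists (fun i j => a i j + b i j).
rewrite -big_split; apply: eq_bigr => i _; rewrite -big_split; apply: eq_bigr => j _.
by rewrite /= actDl.
Qed.

Lemma span_comxZ c f : span_comx f -> span_comx (c *: f).
Proof.
move=> [a ->]; exists (fun i j => c *: a i j).
rewrite scaler_sumr; apply: eq_bigr => i _; rewrite scaler_sumr; apply: eq_bigr => j _.
by rewrite actZl.
Qed.

Lemma span_comx_act p f : span_comx f -> span_comx (act p f).
Proof.
move=> [a ->]; exists (fun i j => p * a i j).
rewrite act_sum_r; apply: eq_bigr => i _; rewrite act_sum_r; apply: eq_bigr => j _.
by rewrite actM //; apply: comx_ideal.
Qed.

Lemma span_comx0 : span_comx 0.
Proof.
by exists (fun _ _ => 0); rewrite big1 // => i _; rewrite big1 // => j _; rewrite act0l.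
Qed.

Lemma span_comx_comx i j : span_comx (comx i j).
Proof.
exists (fun k l => ((k == i) && (l == j))%:R).
rewrite (bigD1 i) //= [X in _ + X]big1 ?addr0 => [|k /negPf ki].
  rewrite (bigD1 j) //= [X in _ + X]big1 ?addr0 => [|l /negPf lj].
    by rewrite !eqxx act1.
  by rewrite lj andbF act0l.
by rewrite big1 // => l _; rewrite ki act0l.
Qed.

Hypothesis gen_ind : forall Q : A -> Prop,
  (forall f g, Q f -> Q g -> Q (f + g)) -> (forall c f, Q f -> Q (c *: f)) ->
  (forall f g, Q f -> Q g -> Q (f * g)) -> Q 1 -> (forall i, Q (x i)) ->
  forall f, Q f.

Lemma span_comxMl h f : span_comx f -> span_comx (h * f).
Proof.
move: h f; apply: gen_ind => [g h Sg Sh f Sf|c g Sg f Sf|g h Sg Sh f Sf|f Sf|i f Sf].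
- by rewrite mulrDl; apply: span_comxD; [apply: Sg | apply: Sh].
- by rewrite -scalerAl; apply/span_comxZ/Sg.
- by rewrite -mulrA; apply/Sg/Sh.
- by rewrite mul1r.
- by rewrite -act_u; apply: span_comx_act.
Qed.

Lemma span_comxMr h f : span_comx f -> span_comx (f * h).
Proof.
move: h f; apply: gen_ind => [g h Sg Sh f Sf|c g Sg f Sf|g h Sg Sh f Sf|f Sf|i f Sf].
- by rewrite mulrDr; apply: span_comxD; [apply: Sg | apply: Sh].
- by rewrite -scalerAr; apply/span_comxZ/Sg.
- by rewrite mulrA; apply/Sh/Sg.
- by rewrite mulr1.
- have -> : f * x i = act (vvar K i) f + act (uvar K i) f by rewrite act_v act_u subrK.
  by apply: span_comxD; apply: span_comx_act.
Qed.

(** The rule [f h, g] = f [h, g] + [f, g] h, and its analogue in the second argument, reduce to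
    commutators of generators. *)
Lemma span_comx_commutator f g : span_comx (f * g - g * f).
Proof.
move: f g; apply: gen_ind => [f h Sf Sh g|c f Sf g|f h Sf Sh g|g|i].
- rewrite mulrDl mulrDr opprD addrACA; exact: span_comxD.
- by rewrite -scalerAl -scalerAr -scalerBr; apply: span_comxZ.
- rewrite -[f * h * g](subrK (f * g * h)) -[_ - _ + _ - _]addrA.
  apply: span_comxD; first by rewrite -!mulrA -mulrBr; apply: span_comxMl.
  by rewrite mulrA -mulrBl; apply: span_comxMr.
- by rewrite mul1r mulr1 subrr; apply: span_comx0.
apply: gen_ind => [f h Sf Sh|c f Sf|f h Sf Sh||j].
- rewrite mulrDl mulrDr opprD addrACA; exact: span_comxD.
- by rewrite -scalerAl -scalerAr -scalerBr; apply: span_comxZ.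
- rewrite -[x i * (f * h)](subrK (f * x i * h)) -[_ - _ + _ - _]addrA.
  apply: span_comxD; first by rewrite mulrA -mulrBl; apply: span_comxMr.
  by rewrite -!mulrA -mulrBr; apply: span_comxMl.
- by rewrite mul1r mulr1 subrr; apply: span_comx0.
- exact: span_comx_comx.
Qed.

Lemma commutator_ideal_span f : I f -> span_comx f.
Proof.
elim=> {f} [_ [f [g ->]]||f g _ Sf _ Sg|h f _ Sf|h f _ Sf].
- exact: span_comx_commutator.
- exact: span_comx0.
- exact: span_comxD.
- exact: span_comxMl.
- exact: span_comxMr.
Qed.

Hypothesis pcharK : [pchar K] =i pred0.
Notation vw := (row_mx 0 (const_mx 1) : 'rV[K]_(d + d)).

(** The weights [vw] are 0 on U and 1 on V: this is the Euler operator of V, and [wt vw] is the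
    degree in V. *)
Lemma lder_diag_v p :
  lder (diag_mx vw) p = \sum_k p^`M(rshift d k) * vvar K k.
Proof.
rewrite /lder big_split_ord /= [X in X + _]big1 ?add0r => [|j _].
  by apply: eq_bigr => k _; rewrite linform_col_diag row_mxEr mxE scale1r.
by rewrite linform_col_diag row_mxEl mxE scale0r mulr0.
Qed.

Lemma wt_v m : wt vw m = (\sum_k m (rshift d k))%:R.
Proof.
rewrite /wt big_split_ord /= [X in X + _]big1 ?add0r => [|j _].
  by rewrite natr_sum; apply: eq_bigr => k _; rewrite row_mxEr mxE.
by rewrite row_mxEl mxE mul0rn.
Qed.

(** Division by the total degree of a 1-form in the dv_i: a coordinate of V-degree r belongs to
    total degree r + 1. *)
Definition vdiv p : P := \sum_(m <- msupp p) ((wt vw m + 1)^-1 * p@_m) *: 'X_[m].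

Lemma mcoeff_vdiv p m : (vdiv p)@_m = (wt vw m + 1)^-1 * p@_m.
Proof.
rewrite /vdiv linear_sum /=; have [pm|pm] := boolP (m \in msupp p).
  rewrite (bigD1_seq m) ?msupp_uniq //= big1 => [|l /negPf lm].
    by rewrite mcoeffZ mcoeffX eqxx mulr1 addr0.
  by rewrite mcoeffZ mcoeffX lm mulr0.
rewrite (memN_msupp_eq0 pm) mulr0 big1_seq // => l /andP[_ pl].
rewrite mcoeffZ mcoeffX; have [e|] := eqVneq l m; last by rewrite mulr0.
by rewrite -e pl in pm.
Qed.

Fact vdiv_is_linear : linear vdiv.
Proof.
move=> c p q; apply/mpolyP => m.
by rewrite mcoeffD mcoeffZ !mcoeff_vdiv mcoeffD mcoeffZ mulrDr mulrCA.
Qed.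
HB.instance Definition _ := GRing.isLinear.Build K P P _ vdiv vdiv_is_linear.

Lemma vdivX m : vdiv 'X_[m] = (wt vw m + 1)^-1 *: 'X_[m].
Proof.
apply/mpolyP => l; rewrite mcoeff_vdiv mcoeffZ mcoeffX.
by have [->|] := eqVneq m l; rewrite ?mulr0.
Qed.

Lemma vdivXv m k :
  vdiv ('X_[m] * vvar K k) = (wt vw m + 2%:R)^-1 *: ('X_[m] * vvar K k).
Proof.
rewrite /vvar -mpolyXD vdivX; congr (_^-1 *: _).
rewrite !wt_v -natrD (eq_bigr (fun l => m (rshift d l) + (k == l))%N).
  rewrite big_split /= [X in (_ + X)%:R](bigD1 k) //=.
  rewrite [X in (_ + (_ + X))%:R]big1 ?eqxx ?addn0 => [|l /negPf lk].
    by rewrite natr1 -addnS.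
  by rewrite eq_sym lk.
by move=> l _; rewrite mnmDE mnm1E eq_rshift.
Qed.

(** The exterior derivative in V of the 1-form p dv_a, with dv_k dv_a replaced by [x_k, x_a]. *)
Definition comx_div p a : A := \sum_k act (p^`M(rshift d k)) (comx k a).

Lemma comx_div_linear a c p q :
  comx_div (c *: p + q) a = c *: comx_div p a + comx_div q a.
Proof.
rewrite /comx_div scaler_sumr -big_split; apply: eq_bigr => k _ /=.
by rewrite linearP /= actDl actZl.
Qed.

Lemma comx_div_mulv p b a : comx_div (p * vvar K b) a =
  \sum_k act (p^`M(rshift d k)) (act (vvar K b) (comx k a)) + act p (comx b a).
Proof.
rewrite /comx_div; under eq_bigr do rewrite mderivM actDl [X in X + _]actM_comx.
rewrite big_split /=; congr (_ + _).
rewrite (bigD1 b) //= big1 ?addr0 => [|k /negPf kb].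
  rewrite /vvar mderivX mnm1E eqxx scale1r.
  have -> : (U_(rshift d b) - U_(rshift d b) = 0 :> 'X_{1..d + d})%MM.
    by apply/mnmP => i; rewrite mnmBE subnn mnm0E.
  by rewrite mpolyX0 mulr1.
by rewrite /vvar mderivX mnm1E eq_rshift eq_sym kb scale0r mulr0 act0l.
Qed.

(** By the Jacobi identity the terms with derivatives of [p] collapse to the Euler operator; the
    derivatives of v_a and v_b contribute twice [p]. *)
Lemma comx_div_koszul p a b :
  comx_div (p * vvar K b) a - comx_div (p * vvar K a) b =
  - act (lder (diag_mx vw) p + 2%:R *: p) (comx a b).
Proof.
rewrite !comx_div_mulv opprD addrACA -sumrB.
under eq_bigr do rewrite -actNr -actDr comx_jacobi actNr -actM_comx.
rewrite sumrN -act_sum_l -lder_diag_v (comxN a b) actNr -opprD -opprD; congr (- _).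
by rewrite actDl scaler_nat mulr2n actDl.
Qed.

(** The j-th coordinate of v_b e_a - v_a e_b, the Koszul image of e_a wedge e_b up to sign. *)
Definition koszul_coord a b j : P := (j == a)%:R * vvar K b - (j == b)%:R * vvar K a.

(** For a monomial [p] of V-degree r, [vdiv] divides by r + 2, which is exactly the factor produced
    by [comx_div_koszul]. *)
Lemma koszul_section p a b :
  \sum_i comx_div (vdiv (p * koszul_coord a b i)) i = - act p (comx a b).
Proof.
have lin0 i : comx_div 0 i = 0.
  by rewrite /comx_div big1 // => k _; rewrite linear0 act0l.
elim/mpolyind: p => [|c m p _ _ IH].
  by rewrite act0l oppr0 big1 // => i _; rewrite mul0r linear0.
under eq_bigr do rewrite mulrDl -scalerAl linearP /= comx_div_linear.
rewrite big_split /= -scaler_sumr IH actDl actZl opprD -scalerN; congr (_ *: _ + _).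
pose g : K := (wt vw m + 2%:R)^-1.
have vdivE i : vdiv ('X_[m] * koszul_coord a b i) = g *: ('X_[m] * koszul_coord a b i).
  rewrite /koszul_coord mulrBr !(mulrCA 'X_[m]) !mulr_natl linearB !linearMn /=.
  by rewrite !vdivXv -scalerN !scalerMnr -scalerDr.
have divZ h q i : comx_div (h *: q) i = h *: comx_div q i.
  by have := comx_div_linear i h q 0; rewrite lin0 !addr0.
under eq_bigr do rewrite vdivE divZ; rewrite -scaler_sumr.
have -> : \sum_i comx_div ('X_[m] * koszul_coord a b i) i =
    comx_div ('X_[m] * vvar K b) a - comx_div ('X_[m] * vvar K a) b.
  have divE i : comx_div ('X_[m] * koszul_coord a b i) i =
      (i == a)%:R *: comx_div ('X_[m] * vvar K b) i -
      (i == b)%:R *: comx_div ('X_[m] * vvar K a) i.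
    rewrite /koszul_coord mulrBr !(mulrCA 'X_[m]) !mulr_natl -!scaler_nat.
    by rewrite comx_div_linear -scaleNr divZ scaleNr.
  have pick (G : 'I_d -> A) k : \sum_i (i == k)%:R *: G i = G k.
    rewrite (bigD1 k) //= big1 ?eqxx ?scale1r ?addr0 // => i /negPf ->.
    by rewrite scale0r.
  by rewrite (eq_bigr _ (fun i _ => divE i)) sumrB !pick.
rewrite comx_div_koszul lder_diagX -scalerDl actZl scalerN scalerA mulVf ?scale1r //.
by rewrite wt_v -natrD addn2; have /pcharf0P -> := pcharK.
Qed.

(* Exactness of the Koszul complex of v_1, ..., v_d in degree 1: in characteristic 0 its
   contracting homotopy is differentiation divided by the degree. *)
Lemma koszul_coord_inj (kap : A -> 'I_d -> P) f :
  (forall f g j, kap (f + g) j = kap f j + kap g j) ->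
  (forall p a b j, kap (act p (comx a b)) j = p * koszul_coord a b j) ->
  I f -> (forall j, kap f j = 0) -> f = 0.
Proof.
move=> kapD kap_act fI kap0.
(* [S] sees [g] only through its coordinates, yet equals - g on the commutator ideal. *)
pose S g := \sum_i comx_div (vdiv (kap g i)) i.
have divD p q i : comx_div (p + q) i = comx_div p i + comx_div q i.
  by have := comx_div_linear i 1 p q; rewrite !scale1r.
have SD g h : S (g + h) = S g + S h.
  by rewrite /S -big_split; apply: eq_bigr => i _; rewrite kapD linearD /= divD.
have S0 g : (forall j, kap g j = 0) -> S g = 0.
  move=> g0; apply: big1 => i _; rewrite g0 linear0.
  by rewrite /comx_div big1 // => k _; rewrite linear0 act0l.
have kap00 j : kap 0 j = 0.
  by apply: (addrI (kap 0 j)); rewrite -kapD !addr0.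
have [a fE] := commutator_ideal_span fI.
suff Sf : S f = - f by apply: oppr_inj; rewrite -Sf S0 // oppr0.
rewrite {1}fE (big_morph S SD (S0 _ kap00)) fE -sumrN; apply: eq_bigr => i _.
rewrite (big_morph S SD (S0 _ kap00)) -sumrN; apply: eq_bigr => j _.
by rewrite -koszul_section; apply: eq_bigr => k _; rewrite kap_act.
Qed.

End MetabelianAlgebra.

(** * Injectivity and equivariance of the Magnus entry [L] *)

Section MagnusEmbedding.
Variables (K : fieldType) (d : nat).
Notation F := (metab K d).
Notation P := {mpoly K[d + d]}.
Notation R := {mpoly K[d + d + d]}.
Notation I := (@commutator_ideal F).
Notation act := (act (@xvar K d)).
Notation com := (comx (@xvar K d)).
Notation L := (@mag K d 0 1).
Notation rho := (@mres K (d + d) d (fun=> 0)).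
Implicit Types (f g : F) (p q : P).

Let u i : R := mincl d (uvar K i).
Let v i : R := mincl d (vvar K i).
Let y i : R := 'X_(rshift (d + d) i).

Let mag_x i : [/\ mag 0 0 (xvar K i) = u i, mag 1 1 (xvar K i) = u i + v i &
  L (xvar K i) = y i].
Proof. by rewrite !mag_xvar !mxE. Qed.

Lemma mag_ideal f : I f -> mag 0 0 f = 0 /\ mag 1 1 f = 0.
Proof.
have m0 g h : mag 0 0 (g * h) = mag 0 0 g * mag 0 0 h.
  by rewrite magM mag10 mulr0 addr0.
have m1 g h : mag 1 1 (g * h) = mag 1 1 g * mag 1 1 h.
  by rewrite magM mag10 mul0r add0r.
elim=> {f} [_ [f [g ->]]||f g _ [f0 f1] _ [g0 g1]|g f _ [f0 f1]|g f _ [f0 f1]].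
- by rewrite !linearB /= !m0 !m1 mulrC subrr mulrC subrr.
- by rewrite !linear0.
- by rewrite !linearD /= f0 f1 g0 g1 addr0.
- by rewrite m0 m1 f0 f1 !mulr0.
- by rewrite m0 m1 f0 f1 !mul0r.
Qed.

(** The diagonal entries of [f] vanish, so x_i multiplies [L f] by u_i from the left and by u_i +
    v_i from the right. *)
Lemma mag_act p f : I f -> L (act p f) = mincl d p * L f.
Proof.
move: p f; apply: mpoly_gen_ind => [p q ep eq|c p ep|p q ep eq||k] f fI.
- by rewrite actDl linearD /= (ep _ fI) (eq _ fI) rmorphD mulrDl.
- by rewrite actZl linearZ /= ep // minclZ scalerAl.
- rewrite actM //; last exact: metab_commutator_idealM.
  by rewrite ep ?eq ?rmorphM ?mulrA //; apply: act_ideal.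
- by rewrite act1 rmorph1 mul1r.
have [f0 f1] := mag_ideal fI.
have Lu i : L (xvar K i * f) = u i * L f.
  by have [x0 _ _] := mag_x i; rewrite magM f1 mulr0 addr0 x0.
case: (split_ordP k) => i ->; first by rewrite -/(uvar K i) act_u Lu.
rewrite -/(vvar K i) act_v linearB /= Lu magM f0 mul0r add0r.
by have [_ -> _] := mag_x i; rewrite /v; ring.
Qed.

Lemma mag_com a b : L (com a b) = y a * v b - y b * v a.
Proof.
have [a0 a1 aL] := mag_x a; have [b0 b1 bL] := mag_x b.
by rewrite linearB /= !magM a0 a1 aL b0 b1 bL; ring.
Qed.

(** On the commutator ideal [L f] is linear in Y, and this is its coefficient of y_j. *)
Definition mag_coord f j : P := rho (L f)^`M(rshift (d + d) j).

Lemma mderiv_mincl p j : (mincl d p)^`M(rshift (d + d) j) = 0.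
Proof.
move: p; apply: mpoly_gen_ind => [p q ep eq|c p ep|p q ep eq||k].
- by rewrite rmorphD mderivD ep eq addr0.
- by rewrite minclZ mderivZ ep scaler0.
- by rewrite rmorphM mderivM ep eq mul0r mulr0 addr0.
- by rewrite rmorph1 -mpolyC1 mderivC.
- by rewrite minclX mderivX mnm1E eq_lrshift scale0r.
Qed.

Lemma mderiv_y a j : (y a)^`M(rshift (d + d) j) = (j == a)%:R.
Proof.
rewrite /y mderivX mnm1E eq_rshift eq_sym; case: eqP => [->|_].
  have -> : (U_(rshift (d + d) a) - U_(rshift (d + d) a) = 0 :> 'X_{1..d + d + d})%MM.
    by apply/mnmP => i; rewrite mnmBE subnn mnm0E.
  by rewrite mpolyX0 scale1r.
by rewrite scale0r.
Qed.

Lemma mag_coord_act p a b j : mag_coord (act p (com a b)) j = p * koszul_coord K a b j.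
Proof.
rewrite /mag_coord mag_act; last exact: comx_ideal.
rewrite mag_com mderivM mderiv_mincl mul0r add0r mderivB !mderivM.
rewrite !mderiv_mincl !mulr0 !addr0 !mderiv_y.
by rewrite rmorphM rmorphB !rmorphM !rmorph_nat /= !minclK.
Qed.

Lemma mag_coordD f g j : mag_coord (f + g) j = mag_coord f j + mag_coord g j.
Proof. by rewrite /mag_coord linearD /= mderivD rmorphD. Qed.

Lemma mag_coord_inj (pcharK : [pchar K] =i pred0) f :
  I f -> (forall j, mag_coord f j = 0) -> f = 0.
Proof.
apply: (koszul_coord_inj (@metab_commutator_idealM K d) (@metab_gen_ind K d)) => //.
- exact: mag_coordD.
- exact: mag_coord_act.
Qed.

Lemma rho_mag f : I f -> rho (L f) = 0.
Proof.
move=> fI.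
have [a ->] := commutator_ideal_span (@metab_commutator_idealM K d)
  (@metab_gen_ind K d) fI.
rewrite linear_sum rmorph_sum big1 // => i _ /=.
rewrite linear_sum rmorph_sum big1 // => j _ /=.
rewrite mag_act; last exact: comx_ideal.
by rewrite mag_com rmorphM rmorphB !rmorphM /= !mresX_r !mul0r subrr mulr0.
Qed.

(** The derivatives of the [c i] come multiplied by [L (g i)], which vanishes at Y = 0; only the
    values of the [c i] at Y = 0 remain. *)
Lemma mag_coord_comb k (c : 'I_k -> R) (g : 'I_k -> F) f j :
  (forall i, I (g i)) -> L f = \sum_i c i * L (g i) ->
  mag_coord f j = \sum_i rho (c i) * mag_coord (g i) j.
Proof.
move=> gI; rewrite /mag_coord => ->; rewrite linear_sum rmorph_sum.
apply: eq_bigr => i _ /=.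
by rewrite mderivM rmorphD !rmorphM /= rho_mag // mulr0 add0r.
Qed.

Section Equivariance.
Variables (delta : F -> F) (alpha : 'M[K]_d).
Hypothesis Ddelta : derivation delta.
Hypothesis delta_x :
  forall j, delta (xvar K j) = \sum_(i < d) alpha i j *: xvar K i.
Notation A2 := (block_mx alpha 0 0 alpha).
Notation A3 := (block_mx A2 0 0 alpha).

Lemma lder_uvar j : lder A2 (uvar K j) = \sum_i alpha i j *: uvar K i.
Proof.
rewrite /uvar -minclX lder_block_l lderX /linform rmorph_sum; apply: eq_bigr => i _ /=.
by rewrite minclZ minclX mxE.
Qed.

Lemma lder_vvar j : lder A2 (vvar K j) = \sum_i alpha i j *: vvar K i.
Proof. exact: lder_block_r. Qed.

(** The u, v and y transform through [alpha] as the x do, so the Leibniz rule carries the identity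
    from the generators to all of [F]. *)
Lemma mag_delta a b f : mag a b (delta f) = lder A3 (mag a b f).
Proof.
have deltaD g h : delta (g + h) = delta g + delta h.
  by have := Ddelta.1 1 g h; rewrite !scale1r.
have delta0 : delta 0 = 0 by apply: (addrI (delta 0)); rewrite -deltaD !addr0.
have deltaZ c g : delta (c *: g) = c *: delta g.
  by have := Ddelta.1 c g 0; rewrite delta0 !addr0.
move: f a b; apply: metab_gen_ind => [g h eg eh|c g eg|g h eg eh||j] a b.
- by rewrite deltaD !linearD /= eg eh.
- by rewrite deltaZ !linearZ /= eg.
- by rewrite Ddelta.2 linearD /= !magM !eg !eh linearD /= !lderM; ring.
- rewrite derivation1 // linear0 mag1; case: eqP => _; rewrite ?linear0 //.
  by rewrite (derivation1 (lder_derivation A3)).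
have lder_u : lder A3 (u j) = \sum_i alpha i j *: u i.
  rewrite lder_block_l lder_uvar rmorph_sum; apply: eq_bigr => i _ /=.
  by rewrite minclZ.
have lder_v : lder A3 (v j) = \sum_i alpha i j *: v i.
  rewrite lder_block_l lder_vvar rmorph_sum; apply: eq_bigr => i _ /=.
  by rewrite minclZ.
rewrite delta_x linear_sum mag_xvar mxE.
under eq_bigr do rewrite linearZ /= mag_xvar mxE.
case: ifP => _; case: ifP => _.
- by rewrite lder_u.
- by rewrite linearD /= lder_u lder_v -big_split; apply: eq_bigr => i _; rewrite scalerDr.
- by rewrite lder_block_r.
- by rewrite linear0 big1 // => i _; rewrite scaler0.
Qed.

(** The diagonal entry [mag 0 0] sends x_j to u_j, so the vanishing of delta^N x_j can be read on
    linear forms as that of column j of alpha^N. *)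
Lemma weitzenboeck_nilmx : weitzenboeck delta -> nilmx alpha.
Proof.
move=> [_ _ _ [N iterN]]; exists N; apply/matrixP => i j; rewrite mxE.
have xj : span_xvar (xvar K j).
  exists (fun i => (i == j)%:R); rewrite (bigD1 j) //= big1 ?eqxx ?scale1r ?addr0 //.
  by move=> k /negPf ->; rewrite scale0r.
have iter_mag k f : mag 0 0 (iter k delta f) = iter k (lder A3) (mag 0 0 f).
  by elim: k => //= k IH; rewrite mag_delta IH.
have := iter_mag N (xvar K j); rewrite iterN // linear0.
have [-> _ _] := mag_x j.
rewrite /u /uvar iter_lder_block_l -minclX iter_lder_block_l iter_lderX => /esym.
rewrite -[0](rmorph0 (mincl d)) => /(can_inj (minclK (fun=> 0))).
rewrite -[0](rmorph0 (mincl d)) => /(can_inj (minclK (fun=> 0))).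
by move=> /(congr1 (mcoeff U_(i)%MM)); rewrite mcoeff_linform mcoeff0 mxE.
Qed.

Lemma deltaP_lder (deltaP : P -> P) : derivation deltaP ->
  (forall j, deltaP (uvar K j) = \sum_(i < d) alpha i j *: uvar K i) ->
  (forall j, deltaP (vvar K j) = \sum_(i < d) alpha i j *: vvar K i) ->
  deltaP =1 lder A2.
Proof.
move=> DP Pu Pv; apply: (@derivation_ext _ _ _ id) => //.
- exact: DP.1.
- exact: linearP.
- exact: DP.2.
- exact: lderM.
move=> k; case: (split_ordP k) => i ->.
  by rewrite -/(uvar K i) Pu lder_uvar.
by rewrite -/(vvar K i) Pv lder_vvar.
Qed.

End Equivariance.

End MagnusEmbedding.

(** * Finite generation of the constants in the commutator ideal *)

Theorem theorem2p3 (K : fieldType) (d : nat)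
  (pcharK : [pchar K] =i pred0) (d_ge2 : (2 <= d)%N)
  (delta : metab K d -> metab K d) (Wdelta : weitzenboeck delta)
  (alpha : 'M[K]_d)
  (delta_x : forall j : 'I_d,
     delta (xvar K j) = \sum_(i < d) alpha i j *: xvar K i)
  (deltaP : {mpoly K[d + d]} -> {mpoly K[d + d]})
  (DdeltaP : derivation deltaP)
  (deltaP_u : forall j : 'I_d,
     deltaP (uvar K j) = \sum_(i < d) alpha i j *: uvar K i)
  (deltaP_v : forall j : 'I_d,
     deltaP (vvar K j) = \sum_(i < d) alpha i j *: vvar K i) :
  finitely_generated (@xvar K d) (constants deltaP)
    (fun f : metab K d => commutator_ideal f /\ constants delta f).
Proof.
have [Ddelta _ _ _] := Wdelta.
have nil_alpha := weitzenboeck_nilmx Ddelta delta_x Wdelta.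
have dP := deltaP_lder DdeltaP deltaP_u deltaP_v.
(* The image under L of the module of constants consists of constants in K[U, V, Y], where finite
   generation is obtained first. *)
pose T t := exists2 f : metab K d,
  commutator_ideal f /\ constants delta f & t = mag 0 1 f.
have [|k [g [gT gP]]] := @nilmx_kernel_fg _ _ _ T pcharK
    (nilmx_block (nilmx_block nil_alpha nil_alpha) nil_alpha).
  by move=> _ [f [_ df] ->]; rewrite -(mag_delta Ddelta delta_x) df linear0.
have /choice[G GP] : forall i, exists f,
    (commutator_ideal f /\ constants delta f) /\ g i = mag 0 1 f.
  by move=> i; have [f fP ->] := gT i; exists f.
exists k, G; split=> [i|f [fI df]]; first by case: (GP i).
have [|c [cK LE]] := gP (mag 0 1 f); first by exists f.
(* The ideal generated by Y is stable under the derivation, so the coefficients remain constants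
   after setting Y = 0. *)
exists (fun i => mres (fun=> 0) (c i)); split=> [i|].
  rewrite /constants dP (@mres_lder _ _ _ _ alpha) ?cK ?rmorph0 // => j.
  by rewrite linear0 big1 // => l _; rewrite scaler0.
have GI i : commutator_ideal (G i) by case: (GP i) => -[].
apply/eqP; rewrite -subr_eq0; apply/eqP; apply: (mag_coord_inj pcharK).
  apply: ideal_genD => //; apply: ideal_genN; apply: ideal_sum => i.
  exact: act_ideal.
move=> j.
(* The difference has image sum_i (c_i - c_i(Y = 0)) L(G_i), whose coefficients vanish at Y = 0;
   hence all its coordinates vanish. *)
rewrite (@mag_coord_comb _ _ _ (fun i => c i - mincl d (mres (fun=> 0) (c i))) G) //.
  by rewrite big1 // => i _; rewrite rmorphB /= minclK subrr mul0r.
rewrite linearB /= LE linear_sum -sumrB; apply: eq_bigr => i _ /=.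
by rewrite mag_act // mulrBl; have [_ ->] := GP i.
Qed.
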